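(* Let $\{W_z:z\in\mathbb{R}^2\}$ be an irreducible Weyl system acting on a Hilbert space $H$, and let $\phi=\{\phi_t:t\ge0\}$ be the (unique) CP semigroup on $\mathcal{B}(H)$ satisfying $\phi_t(W_z)=e^{-t|z|^2}W_z$ for all $z\in\mathbb{R}^2$, $t\ge0$. Then $\phi$ is pure; that is, for every pair of normal states $\rho_1,\rho_2$ of $\mathcal{B}(H)$, $$\lim_{t\to\infty}\|\rho_1\circ\phi_t-\rho_2\circ\phi_t\|=0.$$
   Context: Let $\omega$ be the symplectic form on $\mathbb{R}^2$ given by $\omega((x,y),(x',y'))=\frac12(x'y-xy')$, and let $|z|^2=x^2+y^2$ for $z=(x,y)\in\mathbb{R}^2$. A Weyl system on a Hilbert space $H$ is a strongly continuous map $z\in\mathbb{R}^2\mapsto W_z\in\mathcal{B}(H)$ into the unitary operators satisfying $W_{z_1}W_{z_2}=e^{i\omega(z_1,z_2)}W_{z_1+z_2}$ for all $z_1,z_2\in\mathbb{R}^2$; it is irreducible if the only bounded operators commuting with all $W_z$ are scalars (with $H\neq0$; such an $H$ is automatically separable). A CP semigroup on $\mathcal{B}(H)$ ($H$ a separable Hilbert space) is a semigroup $\phi=\{\phi_t:t\ge0\}$ (that is, $\phi_0=\mathrm{id}$ and $\phi_{s+t}=\phi_s\circ\phi_t$) of normal (i.e. weak$^*$-continuous) completely positive linear maps on $\mathcal{B}(H)$ with $\phi_t(\mathbf{1})=\mathbf{1}$ for all $t$, and such that $t\mapsto\langle\phi_t(A)\xi,\eta\rangle$ is continuous for all $\xi,\eta\in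 H$, $A\in\mathcal{B}(H)$. The existence and uniqueness of a CP semigroup with $\phi_t(W_z)=e^{-t|z|^2}W_z$ may be taken as known. *)

(* Defs.v *)
From HB Require Import structures.
From mathcomp Require Import all_boot all_order all_algebra sesquilinear.
From mathcomp Require Import complex.
From mathcomp Require Import all_classical all_reals all_analysis.

Set Implicit Arguments.
Unset Strict Implicit.
Unset Printing Implicit Defensive.

Import Order.TTheory GRing.Theory Num.Theory Num.Def.
Import numFieldNormedType.Exports.

Local Open Scope classical_set_scope.
Local Open Scope ring_scope.

(* The library equips [K^o] with its norm topology for any [K : numFieldType],
   but the concrete [R[i]] needs its own instances. *)
HB.instance Definition _ (R : realType) :=
  NormedModule.copy R[i] (R[i]^o).

Section BoundedOperators.
Variables (R : realType) (H : normedModType R[i]).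

Definition bounded_operator : {pred H -> H} := fun f =>
  `[< linear f /\ exists M : R[i], forall x, `|f x| <= M * `|x| >].

Record bop := Bop { bop_fun :> H -> H; bopP : bop_fun \in bounded_operator }.

HB.instance Definition _ := [isSub for bop_fun].
HB.instance Definition _ := [Choice of bop by <:].

Lemma bop_linear (A : bop) : linear A.
Proof. by have /asboolP[] := bopP A. Qed.

HB.instance Definition _ (A : bop) :=
  GRing.isLinear.Build _ _ _ _ (A : H -> H) (@bop_linear A).

Lemma bop_bounded (A : bop) : exists M : R[i], forall x, `|A x| <= M * `|x|.
Proof. by have /asboolP[] := bopP A. Qed.

Lemma bop_ext (A B : bop) : (forall x, A x = B x) -> A = B.
Proof. by move=> AB; apply/val_inj/funext. Qed.

Lemma bounded_operator_submod : submod_closed bounded_operator.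
Proof.
split=> [|a f g].
  apply/asboolP; split; first by move=> a u v; rewrite /= scaler0 addr0.
  by exists 0 => x /=; rewrite normr0 mul0r.
move=> /asboolP[lf [M hM]] /asboolP[lg [N hN]]; apply/asboolP; split.
  move=> b u v; rewrite !fctE lf lg !scalerDr !scalerA (mulrC a b).
  by rewrite addrACA.
exists (`|a| * M + N) => x; rewrite !fctE mulrDl.
apply: le_trans (ler_normD _ _) _; apply: lerD; last exact: hN.
by rewrite normrZ -mulrA; apply: ler_wpM2l.
Qed.

HB.instance Definition _ :=
  GRing.isSubmodClosed.Build _ _ bounded_operator bounded_operator_submod.
HB.instance Definition _ := [SubChoice_isSubLmodule of bop by <:].

Lemma bounded_operator_id : (id : H -> H) \in bounded_operator.
Proof. by apply/asboolP; split => //; exists 1 => x; rewrite mul1r. Qed.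

Lemma bounded_operator_comp (A B : bop) : A \o B \in bounded_operator.
Proof.
apply/asboolP; split; first by move=> a u v /=; rewrite !linearP.
have [M hM] := bop_bounded A; have [N hN] := bop_bounded B.
exists (`|M| * N) => x /=; rewrite -mulrA.
have [->|x0] := eqVneq x 0; first by rewrite !linear0 normr0 !mulr0.
have M0 : 0 <= M.
  by rewrite -(pmulr_lge0 _ (_ : 0 < `|x|)) ?normr_gt0// (le_trans _ (hM x)).
by rewrite ger0_norm//; apply: le_trans (hM _) _; apply: ler_wpM2l.
Qed.

Definition bop1 : bop := Bop bounded_operator_id.
Definition bop_comp (A B : bop) : bop := Bop (bounded_operator_comp A B).

Let compA : associative bop_comp.
Proof. by move=> A B D; exact: bop_ext. Qed.
Let comp1l : left_id bop1 bop_comp.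
Proof. by move=> A; exact: bop_ext. Qed.
Let comp1r : right_id bop1 bop_comp.
Proof. by move=> A; exact: bop_ext. Qed.
Let compDl : left_distributive bop_comp +%R.
Proof. by move=> A B D; exact: bop_ext. Qed.
Let compDr : right_distributive bop_comp +%R.
Proof. by move=> A B D; apply: bop_ext => x; exact: linearD. Qed.

HB.instance Definition _ := GRing.Zmodule_isPzRing.Build bop
  compA comp1l comp1r compDl compDr.

Definition opnorm (A : bop) : \bar R :=
  ereal_sup [set (complex.Re `|A x|)%:E | x in [set x : H | `|x| <= 1]].

Definition funnorm (f : bop -> R[i]) : \bar R :=
  ereal_sup [set (complex.Re `|f A|)%:E | A in [set A | (opnorm A <= 1)%E]].

End BoundedOperators.

Notation "''B' ( H )" := (bop H) (at level 8, format "''B' ( H )").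

Section Hilbert.
Variables (R : realType) (H : completeNormedModType R[i]).

(* [dot] is linear in its first argument and conjugate linear in its second. *)
Variable dot : {dot H for @conjC R[i]}.

Definition hilbert_norm := forall x : H, `|x| ^+ 2 = dot x x.

Definition is_adjoint (A B : 'B(H)) := forall x y, dot (A x) y = dot x (B y).

Definition unitary_op (U : 'B(H)) :=
  exists V : 'B(H), [/\ is_adjoint U V, V * U = 1 & U * V = 1].

(* In [R[i]], [0 <= z] means that [z] is real and nonnegative. *)
Definition positive_op (A : 'B(H)) := forall x, 0 <= dot (A x) x.

(* Positivity of a matrix of operators acting on the direct sum of [n] copies
   of [H]. *)
Definition positive_opmx n (A : 'M['B(H)]_n) :=
  forall x : 'I_n -> H, 0 <= \sum_i \sum_j dot (A i j (x j)) (x i).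

Definition completely_positive (Phi : 'B(H) -> 'B(H)) :=
  forall n (A : 'M['B(H)]_n), positive_opmx A -> positive_opmx (map_mx Phi A).

Definition square_summable (x : nat -> H) :=
  cvgn (series (fun n => `|x n| ^+ 2)).

(* The predual of ['B(H)] consists of the functionals
   [A |-> \sum_n <A (x n), y n>] with [x] and [y] square summable. *)
Definition predual_index : set ((nat -> H) * (nat -> H)) :=
  [set p | square_summable p.1 /\ square_summable p.2].

Definition predual_eval (A : 'B(H)) : {ptws predual_index -> R[i]} :=
  fun p => limn (series (fun n => dot (A ((\val p).1 n)) ((\val p).2 n))).

Definition weak_star : Type := initial_topology predual_eval.
HB.instance Definition _ := Topological.on weak_star.

Definition normal_map (Phi : 'B(H) -> 'B(H)) :=
  continuous (Phi : weak_star -> weak_star).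

Record normal_state (rho : 'B(H) -> R[i]) : Prop := {
  state_linear : scalar rho;
  state_positive : forall A, positive_op A -> 0 <= rho A;
  state_unital : rho 1 = 1;
  state_normal : continuous (rho : weak_star -> R[i]) }.

Record cp_semigroup (phi : R -> 'B(H) -> 'B(H)) : Prop := {
  cps_linear : forall t, 0 <= t -> linear (phi t);
  cps_normal : forall t, 0 <= t -> normal_map (phi t);
  cps_cp : forall t, 0 <= t -> completely_positive (phi t);
  cps_unital : forall t, 0 <= t -> phi t 1 = 1;
  cps_id : forall A, phi 0 A = A;
  cps_comp : forall s t A, 0 <= s -> 0 <= t -> phi (s + t) A = phi s (phi t A);
  cps_continuous : forall A x y,
    {within `[0, +oo[, continuous (fun t => dot (phi t A x) y)} }.

Definition pure (phi : R -> 'B(H) -> 'B(H)) :=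
  forall rho1 rho2, normal_state rho1 -> normal_state rho2 ->
    funnorm (fun A => rho1 (phi t A) - rho2 (phi t A)) @[t --> +oo] --> 0%E.

Definition symplectic (z w : R * R) : R := 2^-1 * (w.1 * z.2 - z.1 * w.2).

Definition sqnorm (z : R * R) : R := z.1 ^+ 2 + z.2 ^+ 2.

Definition expi (t : R) : R[i] := (cos t +i* sin t)%C.

Record weyl_system (W : R * R -> 'B(H)) : Prop := {
  weyl_unitary : forall z, unitary_op (W z);
  weyl_strongly_continuous : forall x, continuous (fun z => W z x);
  weyl_mul : forall z w, W z * W w = expi (symplectic z w) *: W (z + w) }.

Definition irreducible (W : R * R -> 'B(H)) :=
  (exists x : H, x != 0) /\
  forall T : 'B(H), (forall z, T * W z = W z * T) -> exists c : R[i], T = c *: (1 : 'B(H)).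

End Hilbert.

(* Main.v *)
Require Import Defs.
From mathcomp Require Import all_boot all_order all_algebra sesquilinear.
From mathcomp Require Import complex.
From mathcomp Require Import all_classical all_reals all_analysis.
From mathcomp Require Import ring lra zify.
Import Order.TTheory GRing.Theory Num.Theory Num.Def.
Import numFieldNormedType.Exports.
Local Open Scope classical_set_scope.
Local Open Scope ring_scope.

Set Implicit Arguments.
Unset Strict Implicit.
Unset Printing Implicit Defensive.

(** The maps [phi t] average [W v * A * (W v)^*] over a centred Gaussian variable
    [v] whose variance grows linearly in [t].  Shifting a wide Gaussian by a
    fixed vector [w] changes it little in total variation, so [phi t A] almost
    commutes with [W w], uniformly over the unit ball ([commutator_coef_small]).
    This forces purity.  If [rho1 (phi t A) - rho2 (phi t A)] stayed away from 0
    for some times [t n] tending to infinity and contractions [A n], the weak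
    limit [T] of [phi (t n) (A n)] along an ultrafilter would commute with every
    [W w], hence be a scalar [c] by irreducibility.  Normal states are continuous
    along bounded weakly convergent nets ([weak_star_net_cvg]), so both states
    would tend to [c], a contradiction.

    The uniform commutator estimate is first proved on the linear span [M] of the
    Weyl operators, where [phi t] multiplies [W z] by a Gaussian factor.  For [A]
    in [M] the coefficient [v |-> <W v A (W v)^* x, y>] is a trigonometric
    polynomial, bounded by [|A| |x| |y|].  The Gaussian average is a limit of
    averages over random walks with binomial weights ([cos_pow_cvg]), and the
    effect of a shift on these averages is controlled by summation by parts
    against unimodal weights whose maximum is of order [p^(-1/2)]
    ([gaussian_shift_bound]).  No integral over the plane occurs.

    The estimate then has to pass from [M] to all bounded operators without
    losing control of norms, which is the content of Kaplansky's density theorem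
    ([kaplansky_estimate]).  A bicommutant argument on finite tuples of vectors
    ([bicommutant]) gives strong density of the self-adjoint part of [M] in the
    self-adjoint operators ([selfadjoint_density]), and the bounded transform
    [f(A) = A (1 + A^2/4)^-1], which is strongly continuous and has norm at most
    1, turns strong approximants of [A] into uniformly bounded approximants of
    [f(A)] ([bounded_approx]).  Weak-star continuity of the functional bounds it
    at [f(A)]; since [A - f(A)] is a quarter of a self-adjoint contraction when
    [A] is one, iteration bounds it at [A].

    The Hilbert space is mostly handled through the real part of its inner
    product: self-adjoint operators form only a real subspace, and a complex
    identity follows from the real one by replacing a vector by its multiple
    by [i]. *)

(** * The underlying real Hilbert space *)

(* Lets the compatibility of norm and inner product be inferred. *)
Existing Class hilbert_norm.

(** The source of all Cauchy-Schwarz inequalities below; the degenerate case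
    [b = 0] forces [p = 0]. *)
Lemma discriminant (R : realType) (a b p : R) : 0 <= b ->
  (forall t, 0 <= a + 2 * t * p + t ^+ 2 * b) -> p ^+ 2 <= a * b.
Proof.
rewrite le_eqVlt => /predU1P[<-|b0] h.
  have [->|p0] := eqVneq p 0; first by rewrite expr0n mulr0.
  have := h (- (a + 1) / (2 * p)).
  rewrite (_ : _ + _ = -1) ?ler0N1//.
  by field.
have := h (- p / b).
rewrite (_ : _ + _ = (a * b - p ^+ 2) / b); last by field; rewrite gt_eqF.
by rewrite pmulr_lge0 ?invr_gt0// subr_ge0.
Qed.

Section RealStructure.
Context {R : realType} {H : completeNormedModType R[i]}.
Variable dot : {dot H for @conjC R[i]}.
Context {Hdot : hilbert_norm dot}.

Definition rdot (x y : H) : R := complex.Re (dot x y).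
Definition rnorm (x : H) : R := complex.Re `|x|.

Lemma rdotE x y : rdot x y = complex.Re (dot x y).
Proof. by []. Qed.

Lemma ReD (a b : R[i]) : complex.Re (a + b) = complex.Re a + complex.Re b.
Proof. by case: a b => [? ?] [? ?]. Qed.

Lemma ImD (a b : R[i]) : complex.Im (a + b) = complex.Im a + complex.Im b.
Proof. by case: a b => [? ?] [? ?]. Qed.

Lemma ReB (a b : R[i]) : complex.Re (a - b) = complex.Re a - complex.Re b.
Proof. by case: a b => [? ?] [? ?]. Qed.

Lemma ReM_real (a : R) (b : R[i]) : complex.Re (a%:C%C * b) = a * complex.Re b.
Proof. by case: b => [? ?] /=; rewrite mul0r subr0. Qed.

Lemma Re_iM (a : R[i]) : complex.Re ('i%C * a) = - complex.Im a.
Proof. by case: a => [? ?] /=; rewrite mul0r mul1r sub0r. Qed.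

Lemma Re_sum (I : Type) (r : seq I) (P : pred I) (F : I -> R[i]) :
  complex.Re (\sum_(i <- r | P i) F i) = \sum_(i <- r | P i) complex.Re (F i).
Proof. by elim/big_rec2: _ => //= i x y _ <-; rewrite ReD. Qed.

Lemma rdotDl x y z : rdot (x + y) z = rdot x z + rdot y z.
Proof. by rewrite /rdot linearDl ReD. Qed.

Lemma rdotBl x y z : rdot (x - y) z = rdot x z - rdot y z.
Proof. by rewrite /rdot linearBl ReB. Qed.

Lemma rdotZl (a : R) x y : rdot (a%:C%C *: x) y = a * rdot x y.
Proof. by rewrite /rdot linearZl_LR ReM_real. Qed.

Lemma rdotC x y : rdot x y = rdot y x.
Proof.
have ReJ (z : R[i]) : complex.Re (conjC z) = complex.Re z by case: z.
by rewrite /rdot hermC expr0 mul1r ReJ.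
Qed.

Lemma rdotDr x y z : rdot x (y + z) = rdot x y + rdot x z.
Proof. by rewrite rdotC rdotDl !(rdotC x). Qed.

Lemma rdotBr x y z : rdot x (y - z) = rdot x y - rdot x z.
Proof. by rewrite rdotC rdotBl !(rdotC x). Qed.

Lemma rdotZr (a : R) x y : rdot x (a%:C%C *: y) = a * rdot x y.
Proof. by rewrite rdotC rdotZl rdotC. Qed.

Lemma rdot0l x : rdot 0 x = 0.
Proof. by rewrite /rdot linear0l. Qed.

Lemma rdot0r x : rdot x 0 = 0.
Proof. by rewrite rdotC rdot0l. Qed.

Lemma rdotNl x y : rdot (- x) y = - rdot x y.
Proof. by rewrite -sub0r rdotBl rdot0l sub0r. Qed.

Lemma rdotNr x y : rdot x (- y) = - rdot x y.
Proof. by rewrite rdotC rdotNl rdotC. Qed.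

Lemma rdot_suml (I : Type) (r : seq I) (P : pred I) (F : I -> H) y :
  rdot (\sum_(i <- r | P i) F i) y = \sum_(i <- r | P i) rdot (F i) y.
Proof.
by elim/big_rec2: _ => [|i a b _ <-]; [exact: rdot0l|rewrite rdotDl].
Qed.

Lemma Im_dot x y : complex.Im (dot x y) = - rdot ('i%C *: x) y.
Proof.
by rewrite /rdot linearZl_LR Re_iM opprK.
Qed.

Lemma rdot_ir x y : rdot x ('i%C *: y) = - rdot ('i%C *: x) y.
Proof.
rewrite /rdot linearZr_LR linearZl_LR Re_iM opprK.
have ReNi (z : R[i]) : complex.Re (conjC 'i%C * z) = complex.Im z.
  by case: z => a b; rewrite /= mul0r sub0r mulNr mul1r opprK.
by rewrite [LHS]ReNi.
Qed.

Lemma rdot_ii x y : rdot ('i%C *: x) ('i%C *: y) = rdot x y.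
Proof.
rewrite rdot_ir scalerA -expr2 sqr_i scaleN1r rdotNl opprK //.
Qed.

Lemma rdot_ixx x : rdot ('i%C *: x) x = 0.
Proof. by have := rdot_ir x x; rewrite rdotC; lra. Qed.

Lemma dotE x y : dot x y = (rdot x y +i* - rdot ('i%C *: x) y)%C.
Proof. by rewrite -Im_dot /rdot; case: (dot x y). Qed.

Lemma dot_ext x x' y y' :
  rdot x y = rdot x' y' -> rdot ('i%C *: x) y = rdot ('i%C *: x') y' ->
  dot x y = dot x' y'.
Proof. by move=> e1 e2; rewrite !dotE e1 e2. Qed.

Lemma rnormE x : `|x| = (rnorm x)%:C%C.
Proof. by rewrite /rnorm RRe_real// normr_real. Qed.

Lemma rnorm_ge0 x : 0 <= rnorm x.
Proof. by have := normr_ge0 x; rewrite rnormE lecR. Qed.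

Lemma rdotxx x : rdot x x = rnorm x ^+ 2.
Proof.
rewrite /rdot -Hdot rnormE expr2 ReM_real /=; by rewrite expr2.
Qed.

Lemma rdot_ge0 x : 0 <= rdot x x.
Proof. by rewrite rdotxx sqr_ge0. Qed.

Lemma rnorm0 : rnorm 0 = 0.
Proof. by rewrite /rnorm normr0. Qed.

Lemma rnorm_eq0 x : rnorm x = 0 -> x = 0.
Proof. by move=> h; apply/normr0_eq0; rewrite rnormE h. Qed.

Lemma rdot_eq0 x : rdot x x = 0 -> x = 0.
Proof. by rewrite rdotxx => /eqP; rewrite sqrf_eq0 => /eqP /rnorm_eq0. Qed.

Lemma ler_rnormD x y : rnorm (x + y) <= rnorm x + rnorm y.
Proof.
have := ler_normD x y; rewrite !rnormE -lecR; by rewrite raddfD.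
Qed.

Lemma rnormN x : rnorm (- x) = rnorm x.
Proof. by rewrite /rnorm normrN. Qed.

Lemma rnormB x y : rnorm (x - y) = rnorm (y - x).
Proof. by rewrite -rnormN opprB. Qed.

Lemma rnormZ (a : R[i]) x : rnorm (a *: x) = complex.Re `|a| * rnorm x.
Proof.
by rewrite /rnorm normrZ normc_def ReM_real.
Qed.

Lemma rnormZR (a : R) x : rnorm (a%:C%C *: x) = `|a| * rnorm x.
Proof. by rewrite rnormZ normc_def /= expr0n addr0 sqrtr_sqr. Qed.

Lemma rnorm_i x : rnorm ('i%C *: x) = rnorm x.
Proof. by rewrite rnormZ normc_def /= expr0n expr1n add0r sqrtr1 mul1r. Qed.

Lemma rdot_CS x y : `|rdot x y| <= rnorm x * rnorm y.
Proof.
rewrite -(@ler_pXn2r _ 2)// ?nnegrE ?mulr_ge0 ?rnorm_ge0//.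
rewrite real_normK ?num_real// exprMn -!rdotxx.
apply: discriminant => [|t]; first exact: rdot_ge0.
have := rdot_ge0 (x + t%:C%C *: y).
rewrite rdotDl !rdotDr !rdotZl !rdotZr (rdotC y x); congr (0 <= _).
ring.
Qed.

Lemma rdot_le x y : rdot x y <= rnorm x * rnorm y.
Proof. exact: le_trans (ler_norm _) (rdot_CS x y). Qed.

(** The hypothesis is the bound that the parallelogram law yields for a sequence
    whose energy is within [1 / k.+1] of the infimum at step [k]. *)
Lemma parallelogram_cauchy (u : nat -> H) :
  (forall k l, rnorm (u k - u l) ^+ 2 <= 2 / k.+1%:R + 2 / l.+1%:R) ->
  exists w, forall k, rnorm (u k - w) ^+ 2 <= 10 / k.+1%:R.
Proof.
move=> hu.
have small (e : R) : 0 < e -> exists k0 : nat, forall k l, (k0 <= k)%N -> (k0 <= l)%N ->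
    rnorm (u k - u l) < e.
  move=> e0; have e2 : 0 < e ^+ 2 / 4 by rewrite divr_gt0// exprn_gt0.
  have [k0 hk0] : exists k0 : nat, k0.+1%:R^-1 < e ^+ 2 / 4.
    by have [k _ /(_ k (leqnn k))] := near_infty_natSinv_lt (PosNum e2); exists k.
  exists k0 => k l hk hl.
  rewrite -(@ltr_pXn2r _ 2)// ?nnegrE ?rnorm_ge0// ?ltW//.
  apply: le_lt_trans (hu k l) _.
  have inv m : (k0 <= m)%N -> m.+1%:R^-1 < e ^+ 2 / 4.
    move=> hm; apply: le_lt_trans hk0.
    by rewrite lef_pV2 ?posrE ?ltr0n// ler_nat.
  rewrite (_ : e ^+ 2 = 2 * (e ^+ 2 / 4) + 2 * (e ^+ 2 / 4)); last by field.
  by rewrite ltrD// ltr_pM2l// inv.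
have /cauchy_cvgP/cvg_ex[w hw] : cauchy (u @ \oo).
  apply/cauchy_ballP => e e0.
  have [er eE] : exists er : R, e = er%:C%C.
    by apply/complex_realP; rewrite gtr0_real.
  move: e0; rewrite eE ltcR => e0.
  have [k0 hk0] := small _ e0.
  exists (u @` [set k | (k0 <= k)%N], u @` [set k | (k0 <= k)%N]) => /=.
    by split; exists k0 => // k /= hk; exists k.
  move=> [_ _] /= [[k hk <-] [l hl <-]].
  by rewrite -ball_normE /ball_/= rnormE ltcR; exact: hk0.
exists w => k.
have {}hw (d : R) : 0 < d -> exists l, forall m, (l <= m)%N -> rnorm (u m - w) < d.
  move=> d0.
  have /cvg_ballP/(_ (d%:C%C)) := hw; rewrite ltcR => /(_ d0)[l _ hl].
  exists l => m /hl /=.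
  by rewrite -ball_normE /ball_/= rnormE ltcR rnormB.
(* for m >= k the distance to [u m] contributes 2 * 4, the tail beyond m at most 2 *)
have k0 : 0 < (k.+1%:R : R)^-1 by rewrite invr_gt0 ltr0n.
have k1 : (k.+1%:R : R)^-1 <= 1 by rewrite invf_le1 ?ltr0n// ler1n.
have [l hl] := hw _ k0.
have := hl _ (leq_maxl l k); set m := maxn l k => hy.
have hm : m.+1%:R^-1 <= k.+1%:R^-1 :> R.
  by rewrite lef_pV2 ?posrE ?ltr0n// ler_nat ltnS leq_maxr.
have := ler_rnormD (u k - u m) (u m - w); rewrite addrA subrK => htri.
have := hu k m; have := rnorm_ge0 (u k - w).
have := rnorm_ge0 (u k - u m); have := rnorm_ge0 (u m - w).
move: hy htri; set x := rnorm (u k - u m); set y := rnorm (u m - w).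
set z := rnorm (u k - w); set p := k.+1%:R^-1 in k0 k1 hm *.
set q := m.+1%:R^-1 in hm *.
move=> hy hz y0 x0 z0 hx.
have : z ^+ 2 <= (x + y) ^+ 2 by rewrite ler_pXn2r// nnegrE addr_ge0.
have : (x + y) ^+ 2 <= 2 * x ^+ 2 + 2 * y ^+ 2.
  by rewrite -subr_ge0 (_ : _ - _ = (x - y) ^+ 2) ?sqr_ge0//; ring.
have : y ^+ 2 <= p by apply: le_trans (_ : p * p <= p); nra.
nra.
Qed.
End RealStructure.

(** * Tuples of vectors and Riesz representation *)

Section Tuples.
Context {R : realType} {H : completeNormedModType R[i]}.
Variable dot : {dot H for @conjC R[i]}.
Context {Hdot : hilbert_norm dot}.
Variable I : finType.
Implicit Types (x y z : I -> H) (S : set (I -> H)).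

Definition tdot x y : R := \sum_i rdot dot (x i) (y i).

Lemma tdotE x y : tdot x y = \sum_i rdot dot (x i) (y i).
Proof. by []. Qed.

Lemma tdotDl x y z : tdot (x + y) z = tdot x z + tdot y z.
Proof. by rewrite -big_split; apply: eq_bigr => i _; rewrite rdotDl. Qed.

Lemma tdotZl (a : R) x y : tdot (a%:C%C *: x) y = a * tdot x y.
Proof. by rewrite mulr_sumr; apply: eq_bigr => i _; rewrite rdotZl. Qed.

Lemma tdotC x y : tdot x y = tdot y x.
Proof. by apply: eq_bigr => i _; rewrite rdotC. Qed.

Lemma tdotNl x y : tdot (- x) y = - tdot x y.
Proof. by rewrite -sumrN; apply: eq_bigr => i _; rewrite rdotNl. Qed.

Lemma tdotBl x y z : tdot (x - y) z = tdot x z - tdot y z.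
Proof. by rewrite tdotDl tdotNl. Qed.

Lemma tdotDr x y z : tdot x (y + z) = tdot x y + tdot x z.
Proof. by rewrite tdotC tdotDl !(tdotC x). Qed.

Lemma tdotBr x y z : tdot x (y - z) = tdot x y - tdot x z.
Proof. by rewrite tdotC tdotBl !(tdotC x). Qed.

Lemma tdotZr (a : R) x y : tdot x (a%:C%C *: y) = a * tdot x y.
Proof. by rewrite tdotC tdotZl tdotC. Qed.

Lemma tdot_ge0 x : 0 <= tdot x x.
Proof. by apply: sumr_ge0 => i _; exact: rdot_ge0. Qed.

Lemma ler_tdot x i : rnorm (x i) ^+ 2 <= tdot x x.
Proof.
rewrite -(rdotxx (dot:=dot)) /tdot (bigD1 i)//= lerDl.
by apply: sumr_ge0 => j _; exact: rdot_ge0.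
Qed.

Lemma tdot_eq0 x : tdot x x <= 0 -> x = 0.
Proof.
move=> x0; apply/funext => i; apply: rnorm_eq0; apply/eqP.
by rewrite -sqrf_eq0 eq_le sqr_ge0 (le_trans (ler_tdot x i)).
Qed.

Lemma tdot_CS x y : tdot x y ^+ 2 <= tdot x x * tdot y y.
Proof.
apply: discriminant => [|t]; first exact: tdot_ge0.
have := tdot_ge0 (x + t%:C%C *: y).
rewrite tdotDl !tdotDr !tdotZl !tdotZr (tdotC y x); congr (0 <= _).
ring.
Qed.

Lemma tdot_young x y : 2 * tdot x y <= tdot y y + tdot x x.
Proof.
by have := tdot_ge0 (x - y); rewrite tdotBl !tdotBr (tdotC y x); lra.
Qed.

Definition real_subspace S :=
  [/\ S 0, forall x y, S x -> S y -> S (x + y)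
     & forall (a : R) x, S x -> S (a%:C%C *: x)].

Definition tclosure S : set (I -> H) :=
  [set w | forall e : R, 0 < e -> exists s, S s /\ tdot (w - s) (w - s) < e].

Lemma tclosure_sub S : S `<=` tclosure S.
Proof.
move=> x Sx e e0; exists x; split=> //.
by rewrite subrr /tdot big1// => i _; rewrite rdot0l.
Qed.

Lemma real_subspaceB S x y : real_subspace S -> S x -> S y -> S (x - y).
Proof.
move=> [_ SD SZ] Sx Sy; apply: SD => //.
suff -> : - y = (-1)%:C%C *: y by exact: SZ.
by rewrite rmorphN1 scaleN1r.
Qed.

Lemma eq0_small_sqr (p q : R) : 0 <= q ->
  (forall e, 0 < e -> p ^+ 2 <= q * e) -> p = 0.
Proof.
move=> q0 h; apply/eqP; rewrite -sqrf_eq0 eq_le sqr_ge0 andbT.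
apply/ler_addgt0Pr => e e0; rewrite add0r.
have q1 : 0 < q + 1 by rewrite ltr_wpDl.
apply: le_trans (h (e / (q + 1)) _) _; first exact: divr_gt0.
by rewrite mulrCA ger_pMr// ler_pdivrMr// mul1r lerDl.
Qed.

Lemma tdot_closure0 S d w : (forall s, S s -> tdot d s = 0) ->
  tclosure S w -> tdot d w = 0.
Proof.
move=> dS wS; apply: (@eq0_small_sqr _ (tdot d d)); first exact: tdot_ge0.
move=> e e0; have [s [Ss hs]] := wS _ e0.
rewrite -[tdot d w]subr0 -(dS _ Ss) -tdotBr.
apply: le_trans (tdot_CS _ _) _.
by apply: ler_wpM2l; [exact: tdot_ge0|exact: ltW].
Qed.

Lemma tclosureB S w w' : real_subspace S ->
  tclosure S w -> tclosure S w' -> tclosure S (w - w').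
Proof.
move=> SS wS wS' e e0; have e4 : 0 < e / 4 by rewrite divr_gt0.
have [s [Ss hs]] := wS _ e4; have [s' [Ss' hs']] := wS' _ e4.
exists (s - s'); split; first exact: real_subspaceB.
have -> : w - w' - (s - s') = (w - s) - (w' - s')
  by rewrite !opprB [s' - s]addrC addrACA [- w' + s']addrC.
have := tdot_ge0 ((w - s) + (w' - s')).
move: hs hs'; move: (w - s) (w' - s') => a b.
by rewrite tdotBl !tdotBr tdotDl !tdotDr (tdotC b a); lra.
Qed.

Lemma tclosureD S w w' : real_subspace S ->
  tclosure S w -> tclosure S w' -> tclosure S (w + w').
Proof.
move=> SS Sw Sw'; rewrite -[w']opprK; apply: tclosureB => //.
by rewrite -sub0r; apply: tclosureB => //; apply: tclosure_sub; case: SS.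
Qed.

(** Uniqueness of the orthogonal projection of [v] onto the closure of [S]. *)
Lemma tclosure_unique S v w w' : real_subspace S ->
  tclosure S w -> tclosure S w' ->
  (forall s, S s -> tdot (w - v) s = 0) ->
  (forall s, S s -> tdot (w' - v) s = 0) -> w = w'.
Proof.
move=> SS wS wS' h h'; apply/eqP; rewrite -subr_eq0; apply/eqP.
apply: tdot_eq0; rewrite (@tdot_closure0 S) ?lexx//; last exact: tclosureB.
move=> s Ss; have := h _ Ss; have := h' _ Ss; rewrite !tdotBl; lra.
Qed.

(** Riesz representation on the closure of a real subspace: [w] minimizes the
    energy [|s|^2 - 2 l(s)], whose minimizing sequences are Cauchy by the
    parallelogram law. *)
Lemma riesz_closure S (l : (I -> H) -> R) (C : R) : real_subspace S ->
  (forall x y, S x -> S y -> l (x + y) = l x + l y) ->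
  (forall a x, S x -> l (a%:C%C *: x) = a * l x) ->
  (forall x, S x -> 2 * l x <= tdot x x + C) ->
  exists2 w, tclosure S w & forall s, S s -> tdot w s = l s.
Proof.
move=> [S0 SD SZ] lD lZ lC.
pose J x := tdot x x - 2 * l x.
have J_inf : has_inf (J @` S).
  split; first by exists (J 0), 0.
  by exists (- C) => _ [x Sx <-]; have := lC _ Sx; rewrite /J; lra.
set m := inf (J @` S).
have mJ x : S x -> m <= J x by move=> Sx; apply: ge_inf; [exact: J_inf.2|exists x].
have kpos (k : nat) : 0 < k.+1%:R^-1 :> R by rewrite invr_gt0 ltr0n.
have /choice[u hu] : forall k : nat, exists x, S x /\ J x < m + k.+1%:R^-1.
  by move=> k; have [_ [x Sx <-] hx] := inf_adherent (kpos k) J_inf; exists x.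
have uS k : S (u k) by case: (hu k).
have uJ k : J (u k) < m + k.+1%:R^-1 by case: (hu k).
have u_cauchy k j : tdot (u k - u j) (u k - u j) <= 2 / k.+1%:R + 2 / j.+1%:R.
  have := mJ _ (SZ 2^-1 _ (SD _ _ (uS k) (uS j))); have := uJ k; have := uJ j.
  rewrite /J tdotZl tdotZr lZ ?lD//; last exact: SD.
  rewrite tdotBl !tdotBr tdotDl !tdotDr (tdotC (u j)).
  set p := _^-1; set q := k.+1%:R^-1; set x := tdot (u j) _; set y := tdot (u k) (u k).
  set z := tdot (u k) (u j); set a := l (u k); set b := l (u j); move: p q x y z a b.
  by move=> p q x y z a b; lra.
have /choice[w hw] : forall i, exists w, forall k, rnorm (u k i - w) ^+ 2 <= 10 / k.+1%:R.
  move=> i; apply: (@parallelogram_cauchy _ _ (fun k => u k i)) => k j.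
  apply: le_trans (u_cauchy k j); exact: (ler_tdot (u k - u j)).
have wu k : tdot (w - u k) (w - u k) <= #|I|%:R * (10 / k.+1%:R).
  rewrite /tdot -sum1_card natr_sum mulr_suml; apply: ler_sum => i _.
  by rewrite mul1r rdotxx/= rnormB; exact: hw.
have small (e c : R) : 0 < e -> 0 <= c -> exists k : nat, c * k.+1%:R^-1 < e.
  move=> e0 c0; have c1 : 0 < c + 1 by rewrite ltr_wpDl.
  have d0 : 0 < e / (c + 1) by exact: divr_gt0.
  have [k _ /(_ k (leqnn k))] := near_infty_natSinv_lt (PosNum d0) => /= hk.
  exists k; apply: le_lt_trans (_ : (c + 1) * k.+1%:R^-1 < _).
    by rewrite ler_wpM2r// ?ltW// ltrDl.
  by rewrite mulrC -ltr_pdivlMr.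
have n10 : 0 <= #|I|%:R * 10 :> R by rewrite mulr_ge0// ler0n.
exists w => [e e0|s Ss].
  have [k hk] := small e _ e0 n10.
  exists (u k); split; first exact: uS.
  by apply: le_lt_trans (wu k) _; rewrite mulrA.
apply/eqP; rewrite -subr_eq0; apply/eqP.
pose q := tdot s s; have q0 : 0 <= q := tdot_ge0 s.
(* the first variation of the energy at [u k] in the direction [s] *)
have var k : (tdot (u k) s - l s) ^+ 2 <= k.+1%:R^-1 * q.
  apply: discriminant => // t.
  have := mJ _ (SD _ _ (uS k) (SZ t _ Ss)); have := uJ k.
  rewrite /J tdotDl !tdotDr tdotZl !tdotZr lD ?lZ//; last exact: SZ.
  rewrite tdotZl (tdotC s (u k)) -/q.
  set p := _^-1; set x := tdot (u k) (u k); set y := tdot (u k) s.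
  set a := l (u k); set b := l s; move: (p) (x) (y) (a) (b) (q).
  by move=> p' x' y' a' b' q'; lra.
apply: (@eq0_small_sqr _ (2 * (#|I|%:R * 10 * q + q))).
  by rewrite mulr_ge0// addr_ge0// mulr_ge0.
move=> e e0; have [k hk] := small e 1 e0 ler01; rewrite mul1r in hk.
have := var k; have := tdot_CS (w - u k) s; rewrite tdotBl -/q.
have := wu k; set d := tdot (w - u k) _; set a := tdot w s; set b := tdot (u k) s.
set p := k.+1%:R^-1 in hk *; rewrite mulrA => hd h1 h2.
have : (a - l s) ^+ 2 <= 2 * (a - b) ^+ 2 + 2 * (b - l s) ^+ 2.
  by rewrite -subr_ge0 (_ : _ - _ = (a - b - (b - l s)) ^+ 2) ?sqr_ge0//; ring.
move=> /le_trans; apply.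
rewrite -mulrDr -mulrA ler_pM2l// mulrDl; apply: lerD.
  apply: le_trans h1 _; rewrite -mulrA (mulrC q) mulrA; apply: ler_wpM2r => //.
  by apply: le_trans hd _; apply: ler_wpM2l => //; exact: ltW.
by apply: le_trans h2 _; rewrite mulrC ler_wpM2l// ltW.
Qed.

End Tuples.

(** * Bounded operators, forms and adjoints *)

Section Operators.
Context {R : realType} {H : completeNormedModType R[i]}.
Variable dot : {dot H for @conjC R[i]}.
Context {Hdot : hilbert_norm dot}.
Implicit Types (A B T : 'B(H)) (x y : H).
Local Notation rdot := (rdot dot).

Lemma bopE A B x : ((A * B) x = A (B x)) * ((A + B) x = A x + B x) *
  ((- A) x = - A x) * ((1 : 'B(H)) x = x) * ((0 : 'B(H)) x = 0).
Proof. by []. Qed.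

Lemma bopZE (c : R[i]) A x : (c *: A) x = c *: A x.
Proof. by []. Qed.

Lemma bopME A B x : (A * B) x = A (B x).
Proof. by []. Qed.

Lemma bopD A x y : A (x + y) = A x + A y.
Proof. exact: linearD. Qed.

Lemma bopB A x y : A (x - y) = A x - A y.
Proof. exact: linearB. Qed.

Lemma bopZ A (c : R[i]) x : A (c *: x) = c *: A x.
Proof. exact: linearZ. Qed.

Lemma bop_scalerAl (c : R[i]) (A B : 'B(H)) : (c *: A) * B = c *: (A * B).
Proof. by apply: bop_ext => x; rewrite bopME !bopZE. Qed.

Lemma bop_scalerAr (c : R[i]) (A B : 'B(H)) : A * (c *: B) = c *: (A * B).
Proof. by apply: bop_ext => x; rewrite bopME !bopZE bopZ. Qed.

Lemma bop_sumE (I : Type) (r : seq I) (P : pred I) (F : I -> 'B(H)) x :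
  (\sum_(i <- r | P i) F i) x = \sum_(i <- r | P i) F i x.
Proof. by elim/big_rec2: _ => // i y A _ <-. Qed.

Lemma bop_sumf A (I : Type) (r : seq I) (P : pred I) (F : I -> H) :
  A (\sum_(i <- r | P i) F i) = \sum_(i <- r | P i) A (F i).
Proof. exact: linear_sum. Qed.

Definition bnd A (c : R) := forall x, rnorm (A x) <= c * rnorm x.

Lemma bop_bnd A : exists2 c : R, 0 <= c & bnd A c.
Proof.
have [M hM] := bop_bounded A; exists `|complex.Re M| => // x.
have := hM x; rewrite !rnormE lecE => /andP[_].
rewrite mulrC ReM_real mulrC /= => /le_trans; apply.
by rewrite ler_wpM2r ?rnorm_ge0// ler_norm.
Qed.

Lemma mk_bop (f : H -> H) (c : R) : linear f ->
  (forall x, rnorm (f x) <= c * rnorm x) -> exists A, forall x, A x = f x.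
Proof.
move=> lf hf; have bf : f \in @bounded_operator R H.
  apply/asboolP; split => //; exists c%:C%C => x.
  by rewrite !rnormE -rmorphM lecR.
by exists (Bop bf).
Qed.

Lemma rdot_inj x x' : (forall y, rdot x y = rdot x' y) -> x = x'.
Proof.
move=> h; apply/eqP; rewrite -subr_eq0; apply/eqP; apply: (@rdot_eq0 _ _ dot).
by rewrite rdotBl h subrr.
Qed.

Lemma riesz (l : H -> R) (c : R) : (forall x y, l (x + y) = l x + l y) ->
  (forall a x, l (a%:C%C *: x) = a * l x) ->
  (forall x, `|l x| <= c * rnorm x) -> exists w, forall x, rdot w x = l x.
Proof.
move=> lD lZ lc.
have [||||w _ hw] := @riesz_closure _ _ dot _ unit setT (fun u => l (u tt)) (c ^+ 2).
- by split.
- by move=> x y _ _; exact: lD.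
- by move=> a x _; exact: lZ.
- move=> x _; rewrite /tdot (big_pred1 tt) => [|[]//]; rewrite rdotxx.
  have := le_trans (ler_norm _) (lc (x tt)).
  have := sqr_ge0 (rnorm (x tt) - c); rewrite sqrrB; lra.
exists (w tt) => x; have := hw (fun=> x) I.
by rewrite /tdot (big_pred1 tt) => [|[]//].
Qed.

Lemma complex_scale (a : R[i]) x :
  a *: x = (complex.Re a)%:C%C *: x + (complex.Im a)%:C%C *: ('i%C *: x).
Proof. by rewrite scalerA -scalerDl [in LHS](complexE a) (mulrC 'i%C). Qed.

(** The balance condition for multiplication by [i] makes the vectors provided by
    [riesz] depend complex linearly on [x]: the form is the real part of a
    sesquilinear one. *)
Lemma form_bop (b : H -> H -> R) (c : R) :
  (forall x x' y, b (x + x') y = b x y + b x' y) ->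
  (forall x y y', b x (y + y') = b x y + b x y') ->
  (forall (a : R) x y, b (a%:C%C *: x) y = a * b x y) ->
  (forall (a : R) x y, b x (a%:C%C *: y) = a * b x y) ->
  (forall x y, b ('i%C *: x) y = - b x ('i%C *: y)) ->
  (forall x y, `|b x y| <= c * rnorm x * rnorm y) ->
  exists2 T : 'B(H), (forall x y, rdot (T x) y = b x y) & bnd T c.
Proof.
move=> bDl bDr bZl bZr bi bc.
have /choice[f hf] : forall x, exists w, forall y, rdot w y = b x y.
  by move=> x; apply: riesz (bDr x) (fun a => bZr a x) (bc x).
have fi x : f ('i%C *: x) = 'i%C *: f x.
  by apply: rdot_inj => y; rewrite hf bi -[RHS]opprK -rdot_ir hf.
have fD x y : f (x + y) = f x + f y.
  by apply: rdot_inj => z; rewrite rdotDl !hf bDl.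
have fZ (a : R) x : f (a%:C%C *: x) = a%:C%C *: f x.
  by apply: rdot_inj => z; rewrite rdotZl !hf bZl.
have lf : linear f.
  by move=> a x y; rewrite fD complex_scale fD !fZ fi -complex_scale.
have fc x : rnorm (f x) <= c * rnorm x.
  have [->|f0] := eqVneq (rnorm (f x)) 0.
    have := bc x (f x); rewrite -hf.
    have [x0|x0] := eqVneq (rnorm x) 0; first by rewrite x0 mulr0.
    have [y y0] : exists y : H, 0 < rnorm y.
      by exists x; rewrite lt_def x0 rnorm_ge0.
    move=> _; rewrite -(pmulr_lge0 _ y0).
    by apply: le_trans (bc x y).
  have fp : 0 < rnorm (f x) by rewrite lt_def f0 rnorm_ge0.
  rewrite -(ler_pM2r fp); apply: le_trans (bc x (f x)).
  by rewrite -hf rdotxx ger0_norm ?sqr_ge0// expr2.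
have [T hT] := mk_bop lf fc.
by exists T => [x y|x]; rewrite hT.
Qed.

Definition radjoint A B := forall x y, rdot (A x) y = rdot x (B y).

Lemma adjoint_radjoint A B : is_adjoint dot A B -> radjoint A B.
Proof. by move=> h x y; rewrite rdotE h. Qed.

Lemma radjoint_adjoint A B : radjoint A B -> is_adjoint dot A B.
Proof. by move=> h x y; apply: dot_ext; rewrite ?h// -h linearZ. Qed.

Lemma radjointC A B : radjoint A B -> radjoint B A.
Proof. by move=> h x y; rewrite rdotC -h rdotC. Qed.

Lemma radjointZ (c : R[i]) (A B : 'B(H)) :
  radjoint A B -> radjoint (c *: A) (c^*%C *: B).
Proof.
move=> /radjoint_adjoint AB; apply: adjoint_radjoint => x y.
have e1 : dot (c *: A x) y = c * dot (A x) y by exact: linearZl_LR.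
have e2 : dot x (c^*%C *: B y) = conjC (c^*%C) * dot x (B y) by exact: linearZr_LR.
by rewrite !bopZE e1 e2 AB; congr (_ * _); case: (c) => a b; rewrite /conjC/= opprK.
Qed.

Lemma radjoint_bnd A B c : radjoint A B -> 0 <= c -> bnd A c -> bnd B c.
Proof.
move=> h c0 hc x.
have [B0|B0] := eqVneq (rnorm (B x)) 0; first by rewrite B0 mulr_ge0// rnorm_ge0.
have Bp : 0 < rnorm (B x) by rewrite lt_def B0 rnorm_ge0.
rewrite -(ler_pM2l Bp) -expr2 -(rdotxx (dot:=dot)) -h mulrCA mulrA.
by apply: le_trans (rdot_le _ _) _; rewrite ler_wpM2r ?rnorm_ge0.
Qed.

Lemma radjoint_ex A : exists B, radjoint A B.
Proof.
have [c c0 hc] := bop_bnd A.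
have [||||||B hB _] := @form_bop (fun x y => rdot x (A y)) c.
- by move=> x x' y; rewrite rdotDl.
- by move=> x y y'; rewrite linearD rdotDr.
- by move=> a x y; rewrite rdotZl.
- by move=> a x y; rewrite linearZ rdotZr.
- by move=> x y; rewrite linearZ rdot_ir opprK.
- move=> x y; apply: le_trans (rdot_CS _ _) _; rewrite mulrAC mulrC.
  by rewrite ler_wpM2r ?rnorm_ge0.
by exists B => x y; rewrite rdotC -hB rdotC.
Qed.

Definition selfadjoint A := radjoint A A.

Lemma bndM A B c d : 0 <= c -> bnd A c -> bnd B d -> bnd (A * B) (c * d).
Proof.
move=> c0 hA hB x; rewrite bopE; apply: le_trans (hA _) _.
by rewrite -mulrA ler_wpM2l.
Qed.

Lemma bnd_le A c d : c <= d -> bnd A c -> bnd A d.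
Proof. by move=> cd h x; apply: le_trans (h x) _; rewrite ler_wpM2r ?rnorm_ge0. Qed.

(** The real and imaginary parts, through which estimates for self-adjoint
    contractions reach all contractions. *)
Lemma cartesian_decomposition A : bnd A 1 -> exists A1 A2 : 'B(H),
  [/\ A = A1 + 'i%C *: A2, selfadjoint A1, selfadjoint A2, bnd A1 1 & bnd A2 1].
Proof.
move=> A1; have [B AB] := radjoint_ex A; have BA := radjointC AB.
have B1 : bnd B 1 by exact: (radjoint_bnd AB).
have h2 : 0 <= 2^-1 :> R by rewrite invr_ge0.
exists ((2^-1 : R)%:C%C *: (A + B)), ((2^-1 : R)%:C%C *: ('i%C *: (B - A))).
split.
- apply: bop_ext => x.
  rewrite -[RHS]/((2^-1 : R)%:C%C *: (A x + B x) +
    'i%C *: ((2^-1 : R)%:C%C *: ('i%C *: (B x - A x)))).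
  rewrite !scalerA mulrAC -expr2 sqr_i mulN1r scaleNr -scalerN opprB -scalerDr.
  rewrite addrACA subrr addr0 -mulr2n -[A x *+ 2]scaler_nat scalerA.
  rewrite (_ : _ * _ = 1) ?scale1r//.
  by rewrite fmorphV rmorph_nat mulVf// pnatr_eq0.
- by move=> x y; rewrite !bopZE !bopE rdotZl rdotZr rdotDl rdotDr AB BA addrC.
- move=> x y; rewrite !bopZE rdotZl rdotZr; congr (_ * _).
  rewrite -[rdot _ y]opprK -rdot_ir -[(B - A) x]/(B x - A x) rdotBl AB BA.
  by rewrite !bopZ -rdotBr -rdotNr -scalerBr -scalerN opprB.
- move=> x; rewrite bopZE rnormZR ger0_norm// bopE.
  have := ler_rnormD (A x) (B x); have := A1 x; have := B1 x.
  by move: (rnorm _) (rnorm _) (rnorm _) (rnorm _) => a b c d; lra.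
- move=> x; rewrite bopZE rnormZR ger0_norm// bopZE rnorm_i.
  have := ler_rnormD (B x) (- A x); rewrite rnormN; have := A1 x; have := B1 x.
  rewrite -[(B - A) x]/(B x - A x).
  by move: (rnorm _) (rnorm _) (rnorm _) (rnorm _) => a b c d; lra.
Qed.

End Operators.

(** * Density of irreducible star-algebras *)

Section Density.
Context {R : realType} {H : completeNormedModType R[i]}.
Variable dot : {dot H for @conjC R[i]}.
Context {Hdot : hilbert_norm dot}.
Local Notation rdot := (rdot dot).
Local Notation tdot := (tdot dot).
Local Notation tclosure := (tclosure dot).
Local Notation radjoint := (radjoint dot).
Local Notation selfadjoint := (selfadjoint dot).

Record irreducible_star_algebra (M : set 'B(H)) : Prop := {
  isa1 : M 1;
  isaD : forall A B, M A -> M B -> M (A + B);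
  isaZ : forall (c : R[i]) A, M A -> M (c *: A);
  isaM : forall A B, M A -> M B -> M (A * B);
  isa_adj : forall A, M A -> exists2 B, M B & radjoint A B;
  isa_comm : forall T, (forall B, M B -> T * B = B * T) ->
    exists c : R[i], T = c *: (1 : 'B(H)) }.

Lemma isaB (M : set 'B(H)) A B : irreducible_star_algebra M ->
  M A -> M B -> M (A - B).
Proof.
move=> hM MA MB; rewrite -scaleN1r.
by apply: (isaD hM) => //; exact: (isaZ hM).
Qed.

Variable M : set 'B(H).
Hypothesis Malg : irreducible_star_algebra M.

Definition amplify (I : Type) (A : 'B(H)) (x : I -> H) : I -> H :=
  fun i => A (x i).

Lemma amplify_adj (I : finType) A B (x y : I -> H) :
  radjoint A B -> tdot (amplify A x) y = tdot x (amplify B y).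
Proof. by move=> h; apply: eq_bigr => i _; exact: h. Qed.

Lemma amplifyB (I : Type) A (x y : I -> H) :
  amplify A (x - y) = amplify A x - amplify A y.
Proof. by apply/funext => i; rewrite /amplify !fctE linearB. Qed.

Lemma amplify_bnd (I : finType) A (x : I -> H) c : 0 <= c -> bnd A c ->
  tdot (amplify A x) (amplify A x) <= c ^+ 2 * tdot x x.
Proof.
move=> c0 hA; rewrite mulr_sumr; apply: ler_sum => i _.
rewrite !rdotxx -exprMn ler_pXn2r ?nnegrE ?mulr_ge0 ?rnorm_ge0//; exact: hA.
Qed.

Definition orbit_space (I : Type) (x : I -> H) : set (I -> H) :=
  [set amplify B x | B in M].

Lemma orbit_real_subspace (I : finType) (x : I -> H) :
  real_subspace (orbit_space x).
Proof.
split.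
- exists 0; last by apply/funext => i.
  by rewrite -(scale0r (1 : 'B(H))); apply: isaZ => //; exact: isa1.
- by move=> _ _ [A MA <-] [B MB <-]; exists (A + B) => //; exact: isaD.
- by move=> a _ [A MA <-]; exists (a%:C%C *: A) => //; exact: isaZ.
Qed.

Lemma tclosure_orbitM (I : finType) (x : I -> H) A w : M A ->
  tclosure (orbit_space x) w -> tclosure (orbit_space x) (amplify A w).
Proof.
move=> MA hw e e0; have [c c0 hc] := bop_bnd A.
have c1 : 0 < c ^+ 2 + 1 by rewrite ltr_wpDl// sqr_ge0.
have [_ [[B MB <-] hs]] := hw (e / (c ^+ 2 + 1)) (divr_gt0 e0 c1).
exists (amplify (A * B) x); split; first by exists (A * B) => //; exact: isaM.
have -> : amplify (A * B) x = amplify A (amplify B x) by [].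
rewrite -amplifyB; apply: le_lt_trans (amplify_bnd _ c0 hc) _.
apply: le_lt_trans (_ : (c ^+ 2 + 1) * tdot (w - amplify B x) (w - amplify B x) < e).
  by rewrite ler_wpM2r ?tdot_ge0// lerDl.
by rewrite mulrC -ltr_pdivlMr.
Qed.

Definition single (I : finType) (j : I) (u : H) : I -> H :=
  fun i => if i == j then u else 0.

Lemma single_sum (I : finType) (x : I -> H) : x = \sum_j single j (x j).
Proof.
apply/funext => i; rewrite fct_sumE (bigD1 i)//= /single eqxx big1 ?addr0//.
by move=> j; rewrite eq_sym => /negbTE ->.
Qed.

Lemma tdot_single (I : finType) (j : I) u y :
  tdot (single j u) y = rdot u (y j).
Proof.
rewrite /tdot (bigD1 j)//= /single eqxx big1 ?addr0// => i /negbTE ->.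
by rewrite rdot0l.
Qed.

(** The bicommutant theorem as a separation statement.  The projection [P] onto
    the closure of the orbit of the tuple [x] commutes with [M] acting
    diagonally, so its matrix entries are scalars, and a scalar matrix commutes
    with the diagonal action of every operator. *)
Lemma bicommutant (I : finType) (x y : I -> H) :
  (forall B, M B -> tdot (amplify B x) y = 0) ->
  forall A, tdot (amplify A x) y = 0.
Proof.
move=> Mxy A; pose S := orbit_space x.
have SS : real_subspace S := orbit_real_subspace x.
have /choice[P hP] : forall v : I -> H, exists w : I -> H, tclosure S w /\
    forall s, S s -> tdot (w - v) s = 0.
  move=> v; have [|||w wS hw] := @riesz_closure _ _ dot _ I S (tdot v) (tdot v v) SS.
  - by move=> ? ? _ _; rewrite tdotDr.
  - by move=> ? ? _; rewrite tdotZr.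
  - by move=> s _; exact: tdot_young.
  exists w; split => // s Ss; by rewrite tdotBl hw// subrr.
have PS v : tclosure S (P v) by case: (hP v).
have PO (v s : I -> H) : S s -> tdot (P v - v) s = 0 by case: (hP v) => _; apply.
have Puniq (v w : I -> H) : tclosure S w -> (forall s, S s -> tdot (w - v) s = 0) -> P v = w.
  by move=> Sw hw; exact: (tclosure_unique SS (PS v) Sw (fun s => PO v s) hw).
have PD (v w : I -> H) : P (v + w) = P v + P w.
  apply: Puniq => [|s Ss]; first exact: tclosureD.
  by rewrite opprD addrACA tdotDl !PO// addr0.
have PB B v : M B -> P (amplify B v) = amplify B (P v).
  move=> MB; apply: Puniq => [|_ [D MD <-]]; first exact: tclosure_orbitM.
  have [B' MB' BB'] := isa_adj Malg MB.
  rewrite -amplifyB (amplify_adj _ _ BB'); apply: (PO v).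
  by exists (B' * D) => //; exact: isaM.
have MZ (c : R[i]) : M (c *: (1 : 'B(H))) by apply: isaZ => //; exact: isa1.
have PZ (c : R[i]) (v : I -> H) : P (c *: v) = c *: P v by exact: (PB (c *: (1 : 'B(H))) v (MZ c)).
have P_contr (v : I -> H) : tdot (P v) (P v) <= tdot v v.
  have hv : tdot (P v) (P v) = tdot v (P v).
    apply/eqP; rewrite -subr_eq0 -tdotBl; apply/eqP.
    exact: (tdot_closure0 (fun s => PO v s) (PS v)).
  have := @tdot_young _ _ dot Hdot I v (P v); rewrite -hv; lra.
have Px : P x = x.
  have Sx : S x by exists 1; [exact: isa1|].
  apply: Puniq; first exact: tclosure_sub.
  by move=> s _; rewrite subrr /tdot; apply: big1 => i _; rewrite rdot0l.
have Py v : tdot (P v) y = 0.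
  by rewrite tdotC (@tdot_closure0 _ _ dot _ _ S)// => _ [B MB <-]; rewrite tdotC Mxy.
have entry i j : exists c : R[i], forall u, P (single j u) i = c *: u.
  have [||T hT] := @mk_bop R H (fun u => P (single j u) i) 1.
  - move=> a u v; have -> : single j (a *: u + v) = a *: single j u + single j v.
      by apply/funext => k; rewrite !fctE /single; case: ifP; rewrite ?scaler0 ?addr0.
    by rewrite PD PZ.
  - move=> u; rewrite mul1r -(@ler_pXn2r _ 2)// ?nnegrE ?rnorm_ge0//.
    apply: le_trans (@ler_tdot _ _ dot Hdot I _ _) _; apply: le_trans (P_contr _) _.
    by rewrite tdot_single /single eqxx rdotxx.
  have [B MB|c hc] := isa_comm Malg (T := T); last first.
    by exists c => u; rewrite -hT hc.
  apply: bop_ext => u; rewrite !bopE !hT.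
  have -> : single j (B u) = amplify B (single j u).
    by apply/funext => k; rewrite /amplify /single; case: ifP; rewrite ?linear0.
  by rewrite PB.
have /choice[c hc] : forall ij : I * I, exists c : R[i], forall u,
    P (single ij.2 u) ij.1 = c *: u by move=> [i j]; exact: entry.
have Psum v : P v = \sum_j P (single j (v j)).
  rewrite {1}(single_sum v); apply: (big_morph P PD).
  by have := PZ 0 0; rewrite !scale0r.
suff <- : P (amplify A x) = amplify A x by exact: Py.
rewrite -[in RHS]Px Psum; apply/funext => i; rewrite fct_sumE /amplify Psum fct_sumE.
by rewrite linear_sum; apply: eq_bigr => j _; rewrite !(hc (i, j)) linearZ.
Qed.

(** A tuple [y] orthogonal to all [B v] with [B] self-adjoint in [M] satisfies
    [<C v, y> + <C y, v> = 0] for every [C] in [M], as is seen on [C] plus its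
    adjoint; by [bicommutant] this persists for arbitrary [C], so that the tuple
    [A v] has no component orthogonal to the closure of the [B v]. *)
Lemma selfadjoint_density (I : finType) (v : I -> H) A (e : R) :
  selfadjoint A -> 0 < e -> exists B, [/\ M B, selfadjoint B
    & forall i, rnorm (B (v i) - A (v i)) < e].
Proof.
move=> Asa e0; pose S := [set amplify B v | B in [set B | M B /\ selfadjoint B]].
have SS : real_subspace S.
  split.
  - exists 0; last by apply/funext => i.
    split; last by move=> x y; rewrite rdot0l rdot0r.
    by rewrite -(scale0r (1 : 'B(H))); apply: isaZ => //; exact: isa1.
  - move=> _ _ [B [MB hB] <-] [C [MC hC] <-]; exists (B + C) => //; split.
      exact: isaD.
    by move=> x y; rewrite !bopE rdotDl rdotDr hB hC.
  - move=> a _ [B [MB hB] <-]; exists (a%:C%C *: B) => //; split.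
      exact: isaZ.
    by move=> x y; rewrite !bopZE rdotZl rdotZr hB.
pose z := amplify A v.
have [|||w wS hw] := @riesz_closure _ _ dot _ I S (tdot z) (tdot z z) SS.
- by move=> ? ? _ _; rewrite tdotDr.
- by move=> ? ? _; rewrite tdotZr.
- by move=> s _; exact: tdot_young.
pose y := z - w.
have yS s : S s -> tdot y s = 0 by move=> Ss; rewrite tdotBl hw// subrr.
pose join (f g : I -> H) (i : I + I) := match i with inl j => f j | inr j => g j end.
have tjoin C : tdot (amplify C (join v y)) (join y v) =
    tdot (amplify C v) y + tdot (amplify C y) v by rewrite tdotE big_sumType.
have := @bicommutant _ (join v y) (join y v) _ A.
rewrite tjoin => zy0.
have zy : tdot z y = 0.
  have /eqP : tdot z y + tdot z y = 0.
    have e1 : tdot z y = tdot (amplify A y) v.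
      by rewrite (amplify_adj v y Asa) tdotC.
    rewrite [X in _ + X]e1.
    apply: zy0 => B MB; rewrite tjoin.
    have [B' MB' BB'] := isa_adj Malg MB.
    rewrite (amplify_adj y v BB') -(tdotC dot (amplify B' v)) -tdotDl.
    have -> : amplify B v + amplify B' v = amplify (B + B') v by [].
    rewrite tdotC; apply: yS; exists (B + B') => //; split; first exact: isaD.
    by move=> p q; rewrite !bopE rdotDl rdotDr BB' (radjointC BB') addrC.
  by rewrite -mulr2n mulrn_eq0 => /eqP.
have y0 : y = 0.
  apply: (@tdot_eq0 _ _ dot _ _ y).
  by rewrite {2}/y tdotBr (tdotC dot y) zy (tdot_closure0 yS wS) subrr.
have zw : z = w by apply/eqP; rewrite -subr_eq0; apply/eqP.
have [_ [[B [MB hB] <-] hz]] := wS (e ^+ 2) (exprn_gt0 _ e0).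
exists B; split => // i; rewrite -(@ltr_pXn2r _ 2)// ?nnegrE ?rnorm_ge0// ?ltW//.
apply: le_lt_trans hz; rewrite -zw rnormB.
exact: (@ler_tdot _ _ dot Hdot I (z - amplify B v)).
Qed.

End Density.

(** * The bounded transform *)

Section Resolvent.
Context {R : realType} {H : completeNormedModType R[i]}.
Variable dot : {dot H for @conjC R[i]}.
Context {Hdot : hilbert_norm dot}.
Local Notation rdot := (rdot dot).
Local Notation tdot := (tdot dot).
Local Notation selfadjoint := (selfadjoint dot).
Implicit Types (A B : 'B(H)) (x y : H).

(** Associated with the quadratic form [|x|^2 + |A x|^2 / 4] when [A] is
    self-adjoint. *)
Definition energy A : 'B(H) := 1 + (4^-1 : R)%:C%C *: (A * A).

Lemma energyE A x : energy A x = x + (4^-1 : R)%:C%C *: A (A x).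
Proof. by []. Qed.

Lemma rnorm_le_energy A x : selfadjoint A -> rnorm x <= rnorm (energy A x).
Proof.
move=> hA; have [x0|x0] := eqVneq (rnorm x) 0; first by rewrite x0 rnorm_ge0.
have xp : 0 < rnorm x by rewrite lt_def x0 rnorm_ge0.
rewrite -(ler_pM2r xp); apply: le_trans (rdot_le (energy A x) x).
rewrite energyE rdotDl rdotZl hA -expr2 rdotxx lerDl.
by rewrite mulr_ge0 ?rdot_ge0// invr_ge0.
Qed.

(** The difference of the squares is [|x - A (A x) / 4|^2].  Consequently the
    bounded transform [A (1 + A^2/4)^-1] has norm at most 1, whatever the norm
    of the self-adjoint operator [A]. *)
Lemma rnorm_op_le_energy A x : selfadjoint A ->
  rnorm (A x) <= rnorm (energy A x).
Proof.
move=> hA; rewrite -(@ler_pXn2r _ 2)// ?nnegrE ?rnorm_ge0//.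
rewrite -!(rdotxx (dot:=dot)).
have := @rdot_ge0 _ _ dot Hdot (x - (4^-1 : R)%:C%C *: A (A x)).
rewrite energyE rdotBl !rdotBr !rdotDl !rdotDr !rdotZl !rdotZr.
rewrite (rdotC dot (A (A x)) x) -(hA x (A x)).
by move: (rdot _ _) (rdot _ _) (rdot _ _) => a b c; lra.
Qed.

Lemma energy_inj A x y : selfadjoint A -> energy A x = energy A y -> x = y.
Proof.
move=> hA xy; apply/eqP; rewrite -subr_eq0; apply/eqP/rnorm_eq0/eqP.
rewrite eq_le rnorm_ge0 andbT; apply: le_trans (rnorm_le_energy _ hA) _.
by rewrite bopB xy subrr rnorm0.
Qed.

(** Solving [x + A (A x) / 4 = v] amounts to representing [y |-> <v, y>] on the
    graph of [A / 2]. *)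
Lemma resolvent_ex A : selfadjoint A ->
  exists2 T : 'B(H), energy A * T = 1 & T * energy A = 1.
Proof.
move=> hA; pose h : R[i] := (2^-1 : R)%:C%C.
pose graph y : bool -> H := fun b => if b then y else h *: A y.
pose S := [set graph y | y in setT].
have SS : real_subspace S.
  split.
  - by exists 0 => //; apply/funext => -[]//=; rewrite linear0 scaler0.
  - move=> _ _ [x _ <-] [y _ <-]; exists (x + y) => //.
    by apply/funext => -[]//=; rewrite !fctE/= bopD scalerDr.
  - move=> a _ [x _ <-]; exists (a%:C%C *: x) => //.
    by apply/funext => -[]//=; rewrite !fctE/= bopZ scalerA mulrC -scalerA.
have tbool u v : tdot u v = rdot (u true) (v true) + rdot (u false) (v false).
  by rewrite tdotE big_bool.
have /choice[f hf] : forall v, exists x, energy A x = v.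
  move=> v.
  have [|||w wS hw] := @riesz_closure _ _ dot _ _ S (fun s => rdot v (s true)) (rdot v v) SS.
  - by move=> s t _ _; rewrite rdotDr.
  - by move=> a s _; rewrite rdotZr.
  - move=> s _; rewrite tbool.
    have := @rdot_ge0 _ _ dot Hdot (v - s true); have := @rdot_ge0 _ _ dot Hdot (s false).
    by rewrite rdotBl !rdotBr (rdotC dot (s true) v); lra.
  exists (w true).
  (* the graph is closed: its orthogonal complement contains all (A u / 2, - u) *)
  have w2 : w false = h *: A (w true).
    apply: (@rdot_inj _ _ dot) => u.
    pose d b := if b then h *: A u else - u.
    have : tdot d w = 0.
      apply: (@tdot_closure0 _ _ dot _ _ S) wS => _ [y _ <-].
      by rewrite tbool/= rdotNl rdotZl rdotZr hA subrr.
    rewrite tbool/= rdotNl rdotZl hA => /eqP; rewrite subr_eq0 => /eqP e1.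
    by rewrite rdotZl rdotC -e1 (rdotC dot u).
  apply: (@rdot_inj _ _ dot) => y.
  have {hw} : tdot w (graph y) = rdot v y by apply: (hw (graph y)); exists y.
  rewrite tbool -[graph y true]/y -[graph y false]/(h *: A y) w2 => <-.
  rewrite energyE rdotDl !rdotZl rdotZr (hA (A _) y) mulrA; congr (_ + _ * _).
  by field.
have lf : linear f.
  by move=> a x y; apply: (energy_inj hA); rewrite bopD bopZ !hf.
have fc x : rnorm (f x) <= 1 * rnorm x.
  by rewrite mul1r -{2}(hf x); exact: rnorm_le_energy.
have [T hT] := mk_bop lf fc.
exists T; apply: bop_ext => x; rewrite bopME hT ?hf//.
by apply: (energy_inj hA); rewrite hf.
Qed.

Lemma resolvent_comm A T : selfadjoint A -> energy A * T = 1 ->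
  T * energy A = 1 -> A * T = T * A.
Proof.
move=> hA AT TA; apply: bop_ext => x; apply: (energy_inj hA).
have e y : energy A (T y) = y by rewrite -[LHS]/((energy A * T) y) AT.
by rewrite !bopME e energyE -bopZ -bopD -energyE e.
Qed.

Lemma resolvent_bnd A T : selfadjoint A -> energy A * T = 1 ->
  bnd T 1 /\ bnd (A * T) 1.
Proof.
move=> hA AT.
have e y : energy A (T y) = y by rewrite -[LHS]/((energy A * T) y) AT.
split=> x; rewrite mul1r -{2}(e x); first exact: rnorm_le_energy.
exact: (rnorm_op_le_energy (T x) hA).
Qed.

Lemma resolvent_selfadjoint A T : selfadjoint A -> energy A * T = 1 ->
  selfadjoint T.
Proof.
move=> hA AT x y.
have e z : energy A (T z) = z by rewrite -[LHS]/((energy A * T) z) AT.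
rewrite -{1}(e y) -{2}(e x) !energyE rdotDr rdotDl rdotZr rdotZl.
by rewrite !hA.
Qed.

(** Strong continuity of [A |-> A (1 + A^2/4)^-1], from the second resolvent
    identity. *)
Lemma resolvent_diff A B T U x : selfadjoint A -> selfadjoint B ->
  energy A * T = 1 -> energy B * U = 1 -> U * energy B = 1 ->
  rnorm (B (U x) - A (T x)) <=
    rnorm (B (T x) - A (T x)) + 4^-1 * rnorm (B (A (T x)) - A (A (T x))).
Proof.
move=> hA hB AT BU UB; set v := T x.
have ex : x = v + (4^-1 : R)%:C%C *: A (A v).
  by rewrite -energyE -[RHS]/((energy A * T) x) AT.
have eU y : U (energy B y) = y by rewrite -[LHS]/((U * energy B) y) UB.
have UBc y : B (U y) = U (B y).
  by have /(congr1 (fun D : 'B(H) => D y)) := resolvent_comm hB BU UB.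
have -> : B (U x) - A v =
    U (B v - A v) - (4^-1 : R)%:C%C *: B (U (B (A v) - A (A v))).
  have e1 : B (U x) = U (B v + (4^-1 : R)%:C%C *: B (A (A v))).
    by rewrite UBc {1}ex bopD bopZ.
  have e2 : A v = U (A v + (4^-1 : R)%:C%C *: B (B (A v))) by rewrite -energyE eU.
  rewrite e1 [X in _ - X = _]e2 UBc -(bopZ U) -!(bopB U); congr (U _).
  by rewrite bopB scalerBr opprB opprD addrACA.
have [U1 BU1] := resolvent_bnd hB BU.
apply: le_trans (ler_rnormD _ _) _; rewrite rnormN rnormZR ger0_norm ?invr_ge0//.
have := U1 (B v - A v); rewrite mul1r => h1.
have := BU1 (B (A v) - A (A v)); rewrite mul1r => h2.
by apply: lerD => //; rewrite ler_wpM2l ?invr_ge0.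
Qed.

Variable M : set 'B(H).
Hypothesis Malg : irreducible_star_algebra dot M.

(** For [B] in [M], the Neumann series of [(1 + B^2/4)^-1] converges in norm, so
    [B (1 + B^2/4)^-1] is a norm limit of elements of [M]. *)
Lemma neumann_approx B U (k : R) : M B -> selfadjoint B ->
  energy B * U = 1 -> U * energy B = 1 -> 0 < k ->
  exists2 Y, M Y & bnd (B * U - Y) k.
Proof.
move=> MB hB BU UB k0; have [b b0 hb] := bop_bnd B.
(* 1 + B^2/4 = (1 - E) / c with |E| <= c r < 1 *)
pose r : R := b ^+ 2 / 4; have r0 : 0 <= r by rewrite divr_ge0// sqr_ge0.
pose c : R := (1 + r)^-1; have c0 : 0 < c by rewrite invr_gt0 ltr_pwDl.
have cE : c * (1 + r) = 1 by rewrite mulVf// gt_eqF// ltr_pwDl.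
pose E : 'B(H) := c%:C%C *: (r%:C%C *: (1 : 'B(H)) - (4^-1 : R)%:C%C *: (B * B)).
have EE x : E x = c%:C%C *: (r%:C%C *: x - (4^-1 : R)%:C%C *: B (B x)) by [].
have E_bnd : bnd E (c * r).
  move=> x; rewrite EE rnormZR (ger0_norm (ltW c0)) -mulrA ler_wpM2l ?(ltW c0)//.
  rewrite -(@ler_pXn2r _ 2)// ?nnegrE ?mulr_ge0 ?rnorm_ge0//.
  rewrite exprMn -!(rdotxx (dot:=dot)) rdotBl !rdotBr !rdotZl !rdotZr.
  rewrite (rdotC dot (B (B x)) x) -(hB x (B x)).
  have : rdot (B (B x)) (B (B x)) <= 4 * r * rdot (B x) (B x).
    rewrite !rdotxx (_ : 4 * r = b ^+ 2); last by rewrite /r; field.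
    by rewrite -exprMn ler_pXn2r ?nnegrE ?mulr_ge0 ?rnorm_ge0//; exact: hb.
  have := mulr_ge0 r0 (@rdot_ge0 _ _ dot Hdot (B x)).
  by move: (rdot _ _) (rdot _ _) (rdot _ _) => p q s; lra.
have En_bnd n : bnd (E ^+ n) ((c * r) ^+ n).
  elim: n => [|n IH]; first by move=> x; rewrite expr0 mul1r.
  by rewrite !exprS; apply: bndM => //; rewrite mulr_ge0// ltW.
have M1 : M 1 := isa1 Malg.
have ME : M E.
  apply: (isaZ Malg); apply: (isaB Malg); first exact: (isaZ Malg).
  by apply: (isaZ Malg); exact: (isaM Malg).
have [Q MQ hQ] : exists2 Q : nat -> 'B(H), forall n, M (Q n) &
    forall n, energy B * Q n = 1 - E ^+ n.
  pose Q := fix Q n : 'B(H) := if n is m.+1 then c%:C%C *: (1 : 'B(H)) + Q m * E else 0.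
  exists Q.
    elim=> [|n IH] /=.
      by rewrite -(scale0r (1 : 'B(H))); apply: (isaZ Malg).
    by apply: (isaD Malg); [exact: (isaZ Malg)|exact: (isaM Malg)].
  elim=> [|n IH]; first by rewrite /= mulr0 expr0 subrr.
  have e1 : energy B * (c%:C%C *: (1 : 'B(H))) = 1 - E.
    apply: bop_ext => x; rewrite bopME bopZE -[RHS]/(x - E x) EE energyE !bopZ.
    have ex : x = c%:C%C *: x + (c * r)%:C%C *: x.
      by rewrite -scalerDl -rmorphD/= -{1}(mulr1 c) -mulrDr cE scale1r.
    rewrite [X in X - _]ex scalerBr opprB !scalerA -!rmorphM/= -addrA; congr (_ + _).
    by rewrite addrC subrK mulrC.
  by rewrite /= mulrDr e1 mulrA IH mulrBl mul1r exprSr addrA subrK.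
have [n hn] : exists n, (c * r) ^+ n < k.
  have cr1 : `|c * r| < 1.
    by rewrite ger0_norm ?mulr_ge0 ?(ltW c0)// -cE ltr_pM2l// ltrDr.
  have /cvgr0Pnorm_lt/(_ _ k0)[n _ hn] := cvg_expr cr1.
  by exists n; apply: le_lt_trans (ler_norm _) (hn n (leqnn n)).
exists (B * Q n); first exact: (isaM Malg).
have -> : B * U - B * Q n = B * U * E ^+ n.
  have -> : E ^+ n = 1 - energy B * Q n by rewrite hQ opprB addrCA subrr addr0.
  by rewrite mulrBr mulr1 -!mulrA (mulrA U) UB mul1r.
apply: bnd_le (ltW hn) _; rewrite -[(c * r) ^+ n]mul1r; apply: bndM => //.
by have [] := resolvent_bnd hB BU.
Qed.

(** [selfadjoint_density] is applied at the vectors [T (v i)] and [A (T (v i))] that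
    occur in [resolvent_diff].  The norm is at most 1 for the transform of the
    approximant, plus the error of [neumann_approx]. *)
Lemma bounded_approx (I : finType) (v : I -> H) A T (e : R) :
  selfadjoint A -> energy A * T = 1 -> 0 < e ->
  exists Y, [/\ M Y, bnd Y 2 & forall i, rnorm (Y (v i) - A (T (v i))) < e].
Proof.
move=> hA AT e0.
pose u (i : I + I) := match i with inl j => T (v j) | inr j => A (T (v j)) end.
have e4 : 0 < e / 4 by rewrite divr_gt0.
have [B [MB hB Bu]] := selfadjoint_density Malg u hA e4.
have [U BU UB] := resolvent_ex hB.
have [k [k0 k1 kv]] : exists k : R, [/\ 0 < k, k <= 1
    & forall i, k * rnorm (v i) < e / 2].
  pose s := 1 + \sum_i rnorm (v i).
  have s0 : 0 < s by rewrite ltr_pwDl// sumr_ge0// => i _; exact: rnorm_ge0.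
  exists (Num.min 1 (e / 2 / s)); split.
  - by rewrite lt_min ltr01 !divr_gt0.
  - by rewrite ge_min lexx.
  move=> i; have vs : rnorm (v i) < s.
    rewrite /s (bigD1 i)//= addrCA ltrDl ltr_pwDl// sumr_ge0// => j _.
    exact: rnorm_ge0.
  apply: le_lt_trans (_ : e / 2 / s * rnorm (v i) < _).
    by rewrite ler_wpM2r ?rnorm_ge0// ge_min lexx orbT.
  by rewrite mulrAC ltr_pdivrMr// ltr_pM2l// divr_gt0.
have [Y MY hY] := neumann_approx MB hB BU UB k0.
have [_ BU1] := resolvent_bnd hB BU.
exists Y; split=> // [x|i].
  have -> : Y x = B (U x) - (B * U - Y) x.
    by rewrite -[(B * U - Y) x]/(B (U x) - Y x) opprB addrC subrK.
  apply: le_trans (ler_rnormD _ _) _; rewrite rnormN.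
  have := hY x; have := BU1 x; rewrite mul1r => h1 h2.
  rewrite mulrDl mul1r lerD//; apply: le_trans h2 _.
  by rewrite ler_piMl// rnorm_ge0.
have -> : Y (v i) - A (T (v i)) =
    - (B * U - Y) (v i) + (B (U (v i)) - A (T (v i))).
  by rewrite -[(B * U - Y) (v i)]/(B (U (v i)) - Y (v i)) opprB addrA subrK.
apply: le_lt_trans (ler_rnormD _ _) _; rewrite rnormN.
have h1 := le_lt_trans (hY (v i)) (kv i).
have h2 := resolvent_diff (v i) hA hB AT BU UB.
have h3 := Bu (inl i); have h4 := Bu (inr i).
move: h1 h2 h3 h4 => /=; move: (rnorm _) (rnorm _) (rnorm _) (rnorm _).
by move=> a b c d; lra.
Qed.

End Resolvent.

(** * The weak-star topology *)

Section InitialTopology.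

Lemma cvg_to_initial (S : choiceType) (T : topologicalType) (f : S -> T)
    (F : set_system S) (s : S) : Filter F ->
  f @ F --> f s -> F --> (s : initial_topology f).
Proof.
move=> FF h A; rewrite nbhsE => -[B [[C oC <-] Cs] BA].
by apply: filterS BA _; apply: h; exact: open_nbhs_nbhs.
Qed.

Lemma cvg_to_ptws (I : Type) (T : topologicalType) (F : set_system (I -> T))
    (f : I -> T) : Filter F ->
  (forall i, (fun g => g i) @ F --> f i) -> F --> (f : {ptws I -> T}).
Proof.
by move=> FF h; apply/cvg_sup => i; apply: cvg_to_initial; exact: h.
Qed.

Lemma complex_cvg (R : realType) (I : Type) (F : set_system I)
    (f g : I -> R) (a b : R) : Filter F -> f @ F --> a -> g @ F --> b ->
  (fun i => (f i +i* g i)%C) @ F --> (a +i* b)%C.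
Proof.
move=> FF fa gb; apply/cvgrPdist_lt => e e0.
have [d ed] : exists d : R, e = d%:C%C by apply/complex_realP; rewrite gtr0_real.
move: e0; rewrite ed ltcR => d0; have d2 : 0 < d / 2 by rewrite divr_gt0.
have /cvgrPdist_lt/(_ _ d2) hf := fa; have /cvgrPdist_lt/(_ _ d2) hg := gb.
apply: filterS2 hf hg => i /= h1 h2; rewrite normc_def/= ltcR.
rewrite -(ltr_pXn2r (n := 2))// ?nnegrE ?sqrtr_ge0 ?ltW//.
rewrite sqr_sqrtr ?addr_ge0 ?sqr_ge0// -(real_normK (num_real (a - f i))).
rewrite -(real_normK (num_real (b - g i))).
have := normr_ge0 (a - f i); have := normr_ge0 (b - g i); nra.
Qed.

Lemma Re_cvg (R : realType) (I : Type) (F : set_system I) (f : I -> R[i]) (a : R[i]) :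
  Filter F -> f @ F --> a -> (fun i => complex.Re (f i)) @ F --> complex.Re a.
Proof.
move=> FF fa; apply/cvgrPdist_lt => e e0.
have /cvgrPdist_lt/(_ e%:C%C) h := fa.
have : \forall t \near F, `|a - f t| < e%:C%C by apply: h; rewrite ltcR.
apply: filterS => i hi; rewrite -ReB -ltcR; apply: le_lt_trans hi.
exact: normc_ge_Re.
Qed.

End InitialTopology.

Section WeakStar.
Context {R : realType} {H : completeNormedModType R[i]}.
Variable dot : {dot H for @conjC R[i]}.
Context {Hdot : hilbert_norm dot}.
Local Notation rdot := (rdot dot).
Implicit Types (A B T : 'B(H)) (x y : nat -> H).

Lemma square_summable_real x : square_summable x ->
  cvgn (series (fun n => rnorm (x n) ^+ 2)).
Proof.
move=> /cvg_cauchy/cauchy_seriesP h.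
apply/cauchy_cvgP/cauchy_seriesP => e e0.
have /h : 0 < e%:C%C by rewrite ltcR.
apply: filterS => n /=.
under eq_bigr do rewrite rnormE -rmorphXn/=.
by rewrite -rmorph_sum/= normc_def/= expr0n addr0 sqrtr_sqr ltcR.
Qed.

Lemma series_tail_small (u : nat -> R) (e : R) : 0 < e -> cvgn (series u) ->
  exists N, forall m, (N <= m)%N -> \sum_(N <= k < m) u k <= e.
Proof.
move=> e0 /cvg_cauchy/cauchy_seriesP/(_ _ e0)[[P Q] [[n1 _ h1] [n2 _ h2]] h].
exists (maxn n1 n2) => m hm; apply: ltW; apply: le_lt_trans (ler_norm _) _.
apply: (h (maxn n1 n2, m)); split => /=.
  by apply: h1; rewrite /= leq_maxl.
by apply: h2; rewrite /=; apply: leq_trans hm; rewrite leq_maxr.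
Qed.

Definition rpair A x y : R := limn (series (fun n => rdot (A (x n)) (y n))).

Lemma rdot_young A x y c n : 0 <= c -> bnd A c ->
  `|rdot (A (x n)) (y n)| <= c * (rnorm (x n) ^+ 2 + rnorm (y n) ^+ 2).
Proof.
move=> c0 hA; apply: le_trans (rdot_CS _ _) _.
have hx := hA (x n); have := rnorm_ge0 (x n); have := rnorm_ge0 (y n).
move: (rnorm (x n)) (rnorm (y n)) (rnorm (A (x n))) hx => p q r hx q0 p0.
apply: le_trans (_ : c * p * q <= _); first by rewrite ler_wpM2r.
rewrite -mulrA ler_wpM2l//; have := sqr_ge0 (p - q); nra.
Qed.

Lemma square_summable_majorant x y c : square_summable x -> square_summable y ->
  cvgn (series (fun n => c * (rnorm (x n) ^+ 2 + rnorm (y n) ^+ 2))).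
Proof.
move=> /square_summable_real hx /square_summable_real hy.
exact: (is_cvg_seriesZ (k := c) (is_cvg_seriesD hx hy)).
Qed.

Lemma rpair_cvg A x y : square_summable x -> square_summable y ->
  cvgn (series (fun n => rdot (A (x n)) (y n))).
Proof.
move=> hx hy; have [c c0 hA] := bop_bnd A; apply: normed_cvg.
have hm := @square_summable_majorant x y c hx hy.
apply: (@series_le_cvg _ (fun n => `|rdot (A (x n)) (y n)|) _ _ _ _ hm) => n.
- exact: normr_ge0.
- by rewrite mulr_ge0// addr_ge0// sqr_ge0.
- exact: rdot_young.
Qed.

(** Splits the complex pairings defining the topology into real ones, so that
    only series of real numbers have to be controlled. *)
Lemma predual_evalE A (p : @predual_index R H) : predual_eval dot A p =
  (rpair A (\val p).1 (\val p).2 +i* - rpair ('i%C *: A) (\val p).1 (\val p).2)%C.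
Proof.
have [px py] : square_summable (\val p).1 /\ square_summable (\val p).2.
  by have := set_valP p.
apply/cvg_lim; first exact: norm_hausdorff.
have -> : (series (fun n => dot (A ((\val p).1 n)) ((\val p).2 n))) =
    (fun n => (series (fun n => rdot (A ((\val p).1 n)) ((\val p).2 n)) n +i*
      - series (fun n => rdot (('i%C *: A) ((\val p).1 n)) ((\val p).2 n)) n)%C).
  apply/funext => n; rewrite /series/=; elim: n => [|n IH].
    by rewrite !big_geq// oppr0.
  by rewrite !big_nat_recr//= IH dotE opprD.
by apply: complex_cvg; [|apply: cvgN]; exact: rpair_cvg.
Qed.

(** The tail is dominated by that of [c (|x n|^2 + |y n|^2)], whatever [A]. *)
Lemma rpair_tail x y c (e : R) : square_summable x -> square_summable y ->
  0 <= c -> 0 < e -> exists N : nat, forall A, bnd A c ->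
    `|rpair A x y - \sum_(k < N) rdot (A (x k)) (y k)| <= e.
Proof.
move=> hx hy c0 e0.
have [N hN] := series_tail_small e0 (@square_summable_majorant x y c hx hy).
exists N => A hA; have cvA := @rpair_cvg A x y hx hy.
pose s := \sum_(k < N) rdot (A (x k)) (y k).
have near_s : \forall m \near \oo,
    `|series (fun n => rdot (A (x n)) (y n)) m - s| <= e.
  exists N => // m /= Nm; rewrite /s -(big_mkord xpredT (fun k => rdot (A (x k)) (y k))).
  rewrite /series/= (big_cat_nat (n := N))//= addrAC subrr add0r.
  apply: le_trans (ler_norm_sum _ _ _) _; apply: le_trans (hN _ Nm).
  by apply: ler_sum => k _; exact: rdot_young.
rewrite ler_distl; apply/andP; split.
  by apply: limr_ge => //; apply: filterS near_s => m; rewrite ler_distl => /andP[].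
by apply: limr_le => //; apply: filterS near_s => m; rewrite ler_distl => /andP[].
Qed.

Lemma rpair_net_cvg (I : Type) (F : set_system I) (B : I -> 'B(H)) T x y c :
  Filter F -> square_summable x -> square_summable y ->
  0 <= c -> bnd T c -> (\forall i \near F, bnd (B i) c) ->
  (forall u v, (fun i => rdot (B i u) v) @ F --> rdot (T u) v) ->
  (fun i => rpair (B i) x y) @ F --> rpair T x y.
Proof.
move=> FF hx hy c0 hT hB BT; apply/cvgrPdist_lt => e e0.
have e4 : 0 < e / 4 by rewrite divr_gt0.
have [N hN] := rpair_tail hx hy c0 e4.
have sumT : (fun i => \sum_(k < N) rdot (B i (x k)) (y k)) @ F -->
    \sum_(k < N) rdot (T (x k)) (y k).
  elim: (N) => [|m IH].
    by under eq_fun do rewrite big_ord0; rewrite big_ord0; exact: cvg_cst.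
  under eq_fun do rewrite big_ord_recr; rewrite big_ord_recr.
  by apply: cvgD => //; exact: BT.
have /cvgrPdist_lt/(_ _ e4) hsum := sumT.
apply: filterS2 hB hsum => i hBi hs; have := hN _ hT; have := hN _ hBi.
move: hs; rewrite !(ltr_norml, ler_norml).
move: (rpair _ _ _) (rpair _ _ _) (\sum_(k < N) _) (\sum_(k < N) _) => p q r s.
by move=> /andP[? ?] /andP[? ?] /andP[? ?]; apply/andP; split; lra.
Qed.

(** By [rpair_tail] a pairing is determined by finitely many coefficients, up to
    an error that is uniform on a bounded net. *)
Lemma weak_star_net_cvg (I : Type) (F : set_system I) (B : I -> 'B(H)) T c :
  Filter F -> 0 <= c -> bnd T c ->
  (\forall i \near F, bnd (B i) c) ->
  (forall u v, (fun i => rdot (B i u) v) @ F --> rdot (T u) v) ->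
  (B : I -> weak_star dot) @ F --> (T : weak_star dot).
Proof.
move=> FF c0 hT hB BT; apply: cvg_to_initial; apply: cvg_to_ptws => p.
have [px py] : square_summable (\val p).1 /\ square_summable (\val p).2.
  by have := set_valP p.
suff h : (fun i => predual_eval dot (B i) p) @ F --> predual_eval dot T p.
  exact: h.
rewrite predual_evalE.
under eq_fun do rewrite predual_evalE.
apply: complex_cvg; first exact: rpair_net_cvg hB BT.
apply: cvgN.
have i1 : complex.Re `|'i%C : R[i]| = 1.
  by rewrite normc_def/= expr0n expr1n add0r sqrtr1.
apply: (@rpair_net_cvg _ F (fun i => 'i%C *: B i) ('i%C *: T) _ _ c) => //.
- by move=> x; rewrite bopZE rnormZ i1 mul1r.
- by apply: filterS hB => i hBi x; rewrite bopZE rnormZ i1 mul1r.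
move=> u v.
have mvi (A : 'B(H)) : rdot (('i%C *: A) u) v = - rdot (A u) ('i%C *: v).
  by rewrite bopZE rdot_ir opprK.
rewrite mvi; under eq_fun do rewrite mvi.
by apply: cvgN; exact: BT.
Qed.

(** Coefficients are pairings with sequences supported at index 0. *)
Lemma rdot_weak_star_continuous (x y : H) :
  continuous ((fun A => rdot (A x) y) : weak_star dot -> R).
Proof.
pose at0 (u : H) n := if n is 0%N then u else 0.
have cst_series (V : normedModType R[i]) (u : nat -> V) :
    (forall n, u n.+1 = 0) -> series u @ \oo --> u 0%N.
  move=> u0; rewrite -(cvg_shiftn 1).
  rewrite (_ : (fun n => _) = cst (u 0%N)); first exact: cvg_cst.
  apply/funext => n; rewrite /series/= addn1 big_nat_recl//=.
  by rewrite big1 ?addr0.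
have at0_ss u : square_summable (at0 u).
  rewrite /square_summable; apply: (cvgP (`|u| ^+ 2)).
  apply: (cst_series _ (fun n => `|at0 u n| ^+ 2)) => n.
  by rewrite /= normr0 expr0n.
have mem_p : (at0 x, at0 y) \in @predual_index R H by rewrite inE; split; exact: at0_ss.
pose p : @predual_index R H := SigSub mem_p.
have evalE (A : 'B(H)) : predual_eval dot A p = dot (A x) y.
  apply/cvg_lim; first exact: norm_hausdorff.
  by apply: cst_series => n /=; rewrite linear0r.
have evalC : continuous ((fun A => predual_eval dot A p) : weak_star dot -> R[i]).
  move=> A.
  apply: (@continuous_comp _ _ _ (predual_eval dot : weak_star dot -> _) (fun g => g p)).
    exact: initial_continuous.
  exact: (@proj_continuous _ (fun=> R[i]) p).
move=> A; have := Re_cvg (nbhs_filter (A : weak_star dot)) (evalC A); rewrite /= evalE.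
by under eq_fun do rewrite evalE.
Qed.

End WeakStar.

(** * Kaplansky's density theorem for functionals *)

Section Kaplansky.
Context {R : realType} {H : completeNormedModType R[i]}.
Variable dot : {dot H for @conjC R[i]}.
Context {Hdot : hilbert_norm dot}.
Local Notation rdot := (rdot dot).
Local Notation selfadjoint := (selfadjoint dot).
Implicit Types (A B T : 'B(H)) (x y : H).

Variable M : set 'B(H).
Hypothesis Malg : irreducible_star_algebra dot M.
Variables (s : 'B(H) -> R) (e K : R).
Hypotheses (e0 : 0 < e)
  (sD : forall A B, s (A + B) = s A + s B)
  (sZ : forall (a : R) A, s (a%:C%C *: A) = a * s A)
  (s_cont : continuous (s : weak_star dot -> R))
  (sK : forall A, bnd A 1 -> `|s A| <= K)
  (sM : forall A, M A -> bnd A 1 -> `|s A| <= e).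

(** The sets of elements of [M] of norm at most 2 that are close to the transform
    on finitely many vectors form a filter base converging to it weak-star. *)
Lemma kaplansky_transform A T : selfadjoint A -> energy A * T = 1 ->
  `|s (A * T)| <= 2 * e.
Proof.
move=> hA AT.
pose near_AT (l : seq H * R) : set 'B(H) := [set Y | [/\ M Y, bnd Y 2
  & forall v, v \in l.1 -> rnorm (Y v - A (T v)) < l.2]].
pose F : set_system 'B(H) := filter_from [set l | 0 < l.2] near_AT.
have FF : Filter F.
  apply: filter_from_filter; first by exists ([::], 1) => /=.
  move=> [l d] [l' d'] /= d0 d0'; exists (l ++ l', Num.min d d') => /=.
    by rewrite lt_min d0.
  move=> Y [MY bY hY]; split; split => // v vl;
    have := hY v; rewrite /= mem_cat vl ?orbT => /(_ isT);
    by rewrite lt_min => /andP[].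
have F_ex (P : set 'B(H)) : F P -> exists2 Y, P Y & M Y /\ bnd Y 2.
  move=> [[l d] /= d0 lP].
  have [Y [MY bY hY]] := bounded_approx Malg (fun i : 'I_(size l) => nth 0 l i) hA AT d0.
  exists Y => //; apply: lP; split => // v /= vl.
  have iv : (index v l < size l)%N by rewrite index_mem.
  by have := hY (Ordinal iv); rewrite /= nth_index.
have F2 : \forall Y \near F, M Y /\ bnd Y 2.
  by exists ([::], 1) => /=; [exact: ltr01|move=> Y []].
have FT : (id : 'B(H) -> weak_star dot) @ F --> (A * T : weak_star dot).
  apply: (@weak_star_net_cvg _ _ dot _ _ _ _ _ 2) => //.
  - have [_ h] := resolvent_bnd hA AT; apply: bnd_le h; lra.
  - by apply: filterS F2 => Y [].
  move=> u v; apply/cvgrPdist_lt => d d0.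
  have v0 : 0 < rnorm v + 1 by rewrite ltr_wpDl// rnorm_ge0.
  exists ([:: u], d / (rnorm v + 1)) => /=; first exact: divr_gt0.
  move=> Y [_ _ /(_ u)]; rewrite inE eqxx => /(_ isT) hY.
  rewrite distrC -rdotBl; apply: le_lt_trans (rdot_CS _ _) _.
  rewrite ltr_pdivlMr// in hY; apply: le_lt_trans hY.
  by rewrite ler_wpM2l ?rnorm_ge0// lerDl.
apply/ler_addgt0Pr => d d0.
have /cvgrPdist_lt/(_ _ d0)/F_ex[Y hY [MY bY]] : s @ F --> s (A * T).
  exact: (cvg_comp _ _ FT (@s_cont (A * T))).
have half : `|2^-1 * s Y| <= e.
  rewrite -sZ; apply: sM; first exact: (isaZ Malg).
  move=> x; rewrite bopZE rnormZR ger0_norm ?invr_ge0//.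
  have := bY x; lra.
move: half hY; rewrite !(ler_norml, ltr_norml) => /andP[? ?] /andP[? ?].
by apply/andP; split; lra.
Qed.

(** Write [A = f(A) + G / 4] with [f(A) = A (1 + A^2/4)^-1] bounded by
    [kaplansky_transform] and [G = A^2 f(A)] again a self-adjoint contraction: the
    a priori bound [K] is divided by 4 at each iteration, so that only the bound
    on the unit ball of [M] survives. *)
Lemma kaplansky_estimate A : selfadjoint A -> bnd A 1 -> `|s A| <= 3 * e.
Proof.
have step n : forall A, selfadjoint A -> bnd A 1 ->
    `|s A| <= 8 / 3 * e + K * (4^-1) ^+ n.
  elim: n => [|n IH] {}A hA A1.
    by rewrite expr0 mulr1; apply: le_trans (sK A1) _; rewrite lerDr mulr_ge0 ?divr_ge0 ?(ltW e0).
  have [T AT TA] := resolvent_ex hA.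
  pose G := A * (A * (A * T)).
  have [_ AT1] := resolvent_bnd hA AT.
  have G1 : bnd G 1.
    by rewrite -[1]mulr1; apply: bndM => //; rewrite -[1]mulr1; apply: bndM.
  have hT := resolvent_selfadjoint hA AT.
  have hG : selfadjoint G.
    move=> x y; have c := resolvent_comm hA AT TA.
    rewrite -[G x]/(A (A (A (T x)))) !hA hT.
    have cE z : T (A z) = A (T z) by rewrite -[LHS]/((T * A) z) -c.
    by rewrite !cE.
  have -> : A = A * T + (4^-1 : R)%:C%C *: G.
    apply: bop_ext => x; rewrite -[X in A X]/((1 : 'B(H)) x) -AT.
    by rewrite bopME energyE bopD bopZ.
  rewrite sD sZ; apply: le_trans (ler_normD _ _) _.
  have := kaplansky_transform hA AT; have := IH _ hG G1.
  rewrite normrM (ger0_norm (_ : 0 <= 4^-1)) ?invr_ge0// exprS.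
  move: (_ ^+ n) => q; move: (normr _) (normr _) => a b; lra.
move=> hA A1; have e3 : 0 < e / 3 by rewrite divr_gt0.
have K1 : 0 < `|K| + 1 by rewrite ltr_wpDl.
have q1 : `|4^-1 : R| < 1 by rewrite ger0_norm ?invr_ge0// invf_lt1// ltr1n.
have /cvgr0Pnorm_lt/(_ _ (divr_gt0 e3 K1))[n _ hn] := cvg_expr q1.
have {}hn := hn n (leqnn n); rewrite /= ltr_pdivlMr// in hn.
apply: le_trans (step n A hA A1) _.
have : K * 4^-1 ^+ n <= e / 3.
  apply: le_trans (ler_norm _) _; rewrite normrM mulrC; apply: le_trans (ltW hn).
  by rewrite ler_wpM2l// lerDl.
lra.
Qed.

End Kaplansky.

(** * Binomial weights *)

Section UnimodalSums.
Context {R : realType}.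

(** Summation by parts leaves the increments of [c], which are nonnegative and
    telescope to at most [c p]. *)
Lemma monotone_abel (c b : nat -> R) (p : nat) (K : R) :
  (forall i, (i <= p)%N -> 0 <= c i) ->
  (forall i, (i < p)%N -> c i <= c i.+1) -> (forall i, `|b i| <= K) ->
  `|\sum_(0 <= i < p) c i * (b i - b i.+1) + c p * b p| <= K * c p.
Proof.
move=> + + hb; elim: p => [|p IH] c0 cS.
  rewrite big_geq// add0r normrM (ger0_norm (c0 _ _))// mulrC.
  by rewrite ler_wpM2r// c0.
have {}IH := IH (fun i ip => c0 i (leqW ip)) (fun i ip => cS i (leqW ip)).
rewrite big_nat_recr//=.
have -> : \sum_(0 <= i < p) c i * (b i - b i.+1) + c p * (b p - b p.+1) +
    c p.+1 * b p.+1 = \sum_(0 <= i < p) c i * (b i - b i.+1) + c p * b p +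
    (c p.+1 - c p) * b p.+1 by ring.
apply: le_trans (ler_normD _ _) _.
have -> : K * c p.+1 = K * c p + (c p.+1 - c p) * K by ring.
apply: lerD => //; rewrite normrM ger0_norm ?subr_ge0 ?cS//.
by rewrite ler_wpM2l// subr_ge0 cS.
Qed.

(** A shift costs twice the maximum of symmetric unimodal weights: each half of
    the sum is handled by [monotone_abel], the second one read backwards. *)
Lemma unimodal_abel (c b : nat -> R) (p : nat) (K : R) :
  (forall i, 0 <= c i) -> (forall i, (i < p)%N -> c i <= c i.+1) ->
  (forall i, (i <= p)%N -> c (2 * p - i)%N = c i) -> (forall i, `|b i| <= K) ->
  `|\sum_(0 <= i < (2 * p).+1) c i * (b i - b i.+1)| <= 2 * (K * c p).
Proof.
move=> c0 cS cC hb.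
pose b' i := b (2 * p + 1 - i)%N.
have h1 := @monotone_abel c b p K (fun i _ => c0 i) cS hb.
have h2 := @monotone_abel c b' p K (fun i _ => c0 i) cS (fun i => hb _).
have pp : (2 * p = p + p)%N by rewrite mul2n addnn.
have -> : \sum_(0 <= i < (2 * p).+1) c i * (b i - b i.+1) =
    (\sum_(0 <= i < p) c i * (b i - b i.+1) + c p * b p) -
    (\sum_(0 <= i < p) c i * (b' i - b' i.+1) + c p * b' p).
  rewrite (big_cat_nat (n := p))//=; last by rewrite pp -addnS leq_addr.
  rewrite [X in _ + X]big_ltn; last by rewrite pp -addnS -[X in (X < _)%N]addn0 ltn_add2l.
  have -> : \sum_(p.+1 <= i < (2 * p).+1) c i * (b i - b i.+1) =
      - \sum_(0 <= i < p) c i * (b' i - b' i.+1).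
    rewrite -{1}[p.+1]add0n big_addn pp subSS addnK big_nat_rev -sumrN.
    apply: eq_big_nat => i /= ip; rewrite /b' pp add0n.
    have -> : (p - i.+1 + p.+1 = p + p - i)%N.
      by rewrite addnS -addSn -subSn// subSS addnBAC// ltnW.
    rewrite -pp cC ?(ltnW ip)// -mulrN opprB; congr (_ * (b _ - b _)).
      by lia.
    by lia.
  have -> : b' p = b p.+1 by rewrite /b' pp -addnA addKn addn1.
  by ring.
apply: le_trans (ler_normB _ _) _; rewrite -[2]/(1 + 1) mulrDl mul1r.
exact: lerD.
Qed.

(** The probability that a symmetric walk of [2 * p] steps goes up [i] times. *)
Definition binw (p i : nat) : R := 'C(2 * p, i)%:R / 4 ^+ p.

Lemma binw_ge0 p i : 0 <= binw p i.
Proof. by rewrite divr_ge0// exprn_ge0. Qed.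

Lemma binw_le p i : (i < p)%N -> binw p i <= binw p i.+1.
Proof.
move=> ip; rewrite ler_wpM2r ?invr_ge0 ?exprn_ge0// ler_nat.
rewrite -(leq_pmul2l (ltn0Sn i)) mul_bin_left leq_mul2r; apply/orP; right.
by rewrite leq_subRL mul2n -addnn ?leq_add// ltnW// (leq_trans ip)// leq_addr.
Qed.

Lemma binw_sym p i : (i <= p)%N -> binw p (2 * p - i) = binw p i.
Proof.
move=> ip; rewrite /binw bin_sub// mul2n -addnn.
by rewrite (leq_trans ip)// leq_addr.
Qed.

(** The ratio of consecutive central weights is [(2p+1)/(2p+2)], and
    [(2p+1)(2p+3) <= (2p+2)^2] makes [(2p+1) binw p p ^+ 2] decrease with [p]. *)
Lemma binw_central p : (2 * p)%:R * binw p p ^+ 2 <= 1.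
Proof.
apply: le_trans (_ : (2 * p + 1)%:R * binw p p ^+ 2 <= 1).
  by rewrite ler_wpM2r ?sqr_ge0// ler_nat leq_addr.
elim: p => [|p IH]; first by rewrite /binw muln0 bin0 expr0 divr1 expr1n mulr1.
have rec : (p.+1 * 'C(2 * p.+1, p.+1) = 2 * (2 * p + 1) * 'C(2 * p, p))%N.
  have d1 := mul_bin_diag (2 * p.+1) p; have d2 := mul_bin_diag (2 * p + 1) p.
  have e1 : ((2 * p.+1).-1 = 2 * p + 1)%N by lia.
  have e2 : ((2 * p + 1).-1 = 2 * p)%N by lia.
  have e3 : (2 * p + 1 - p.+1 = p)%N by lia.
  have e4 : (p.+1 <= 2 * p + 1)%N by lia.
  rewrite e1 in d1; rewrite e2 in d2; have := bin_sub e4; rewrite e3 => e5.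
  by rewrite -d1 e5 -[(2 * p.+1)%N]/(2 * p.+1)%N -!mulnA d2.
have p1 : (p.+1%:R : R) != 0 by rewrite pnatr_eq0.
have -> : binw p.+1 p.+1 = binw p p * ((2 * p + 1)%:R / (2 * p + 2)%:R).
  rewrite /binw exprS.
  have -> : 'C(2 * p.+1, p.+1)%:R = 2 * (2 * p + 1)%:R * 'C(2 * p, p)%:R / p.+1%:R :> R.
    by rewrite -!natrM -rec natrM mulrC mulKf.
  have -> : (2 * p + 2)%:R = 2 * p.+1%:R :> R by rewrite -natrM mulnS addnC.
  have f4 : (4 : R) ^+ p != 0 by rewrite expf_neq0.
  move: (4 ^+ p) (p.+1%:R) f4 p1 => r q r0 q0.
  by field; rewrite ?r0 ?q0.
apply: le_trans IH; rewrite exprMn mulrCA [leRHS]mulrC ler_wpM2l ?sqr_ge0//.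
have q0 : 0 < (2 * p + 2)%:R :> R by rewrite ltr0n addn2.
rewrite exprMn exprVn mulrA ler_pdivrMr ?exprn_gt0// !natrD !natrM.
set q : R := p%:R; have : 0 <= q by rewrite ler0n.
rewrite mulrS; nra.
Qed.

End UnimodalSums.

(** * The central limit theorem on the Fourier side *)

Section Characters.
Context {R : realType}.

Lemma expiD (a b : R) : expi (a + b) = expi a * expi b.
Proof. by rewrite /expi cosD sinD; congr Complex; rewrite addrC. Qed.

Lemma expi0 : expi (0 : R) = 1.
Proof. by rewrite /expi cos0 sin0. Qed.

Lemma expiX (a : R) n : expi a ^+ n = expi (n%:R * a).
Proof.
elim: n => [|n IH]; first by rewrite expr0 mul0r expi0.
by rewrite exprS IH -expiD -[n.+1]add1n natrD mulrDl mul1r.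
Qed.

(** The characteristic function of the walk, by expanding
    [(expi (u/2) + expi (- u/2)) ^+ (2 * p)]. *)
Lemma binw_char p (u : R) :
  \sum_(0 <= a < (2 * p).+1) (binw p a)%:C%C * expi ((a%:R - p%:R) * u) =
  (cos (u / 2) ^+ (2 * p))%:C%C.
Proof.
have e4 : (4 ^+ p : R) = 2 ^+ (2 * p) by rewrite exprM; congr (_ ^+ _); rewrite expr2; ring.
have two : (2 * cos (u / 2))%:C%C = expi (- (u / 2)) + expi (u / 2).
  rewrite /expi cosN sinN.
  by apply/eqP; rewrite eq_complex/= addNr eqxx andbT; apply/eqP; ring.
have -> : cos (u / 2) ^+ (2 * p) = (4 ^+ p)^-1 * (2 * cos (u / 2)) ^+ (2 * p).
  by rewrite exprMn e4 mulKf// expf_neq0.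
rewrite rmorphM rmorphXn/= two (exprDn (expi _)) big_mkord mulr_sumr.
apply: eq_bigr => -[a /= ap] _; rewrite ltnS in ap.
have -> : (binw p a)%:C%C = (4 ^- p)%:C%C * 'C(2 * p, a)%:R :> R[i].
  by rewrite /binw mulrC rmorphM/= rmorph_nat.
rewrite -mulrA -[X in _ = _ * X]mulr_natl; congr (_ * (_ * _)).
rewrite !expiX -expiD; congr expi; rewrite natrB// natrM; by field.
Qed.

Lemma binw_sum p : \sum_(0 <= a < (2 * p).+1) binw p a = 1 :> R.
Proof.
have := binw_char p 0; rewrite mul0r cos0 expr1n.
under eq_bigr do rewrite mulr0 expi0 mulr1.
by rewrite -rmorph_sum => /complexI.
Qed.

Lemma sin_quotient (y : R) : (fun n => n.+1%:R * sin (y / n.+1%:R)) @ \oo --> y.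
Proof.
have [->|y0] := eqVneq y 0.
  under eq_fun do rewrite mul0r sin0 mulr0.
  exact: cvg_cst.
have hy : (fun n => y / n.+1%:R) @ \oo --> (0 : R)^'.
  have h0 : (fun n => y / n.+1%:R) @ \oo --> (0 : R).
    by rewrite -[X in _ --> X](mulr0 y); apply: cvgM; [exact: cvg_cst|exact: cvg_harmonic].
  move=> P /= [d d0 dP]; have /cvgrPdist_lt/(_ _ d0) := h0.
  apply: filterS => n hn; apply: dP => //.
  by rewrite mulf_neq0// invr_eq0 pnatr_eq0.
have quot : h^-1 *: (sin (h *: (1 : R) + 0) - sin 0) @[h --> (0 : R)^'] --> (1 : R).
  have d1 : 'D_1 sin 0 = 1 :> R by rewrite derive_val cos0.
  by rewrite -[X in _ --> X]d1; exact: (@derivable_sin R 0).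
have := cvg_comp _ _ hy quot => /(cvgM (cvg_cst y)).
rewrite mulr1; apply: cvg_trans; apply: near_eq_cvg; near=> n.
rewrite /= addr0 sin0 subr0 /GRing.scale/= mulr1 invfM invrK mulrA mulrA mulfV// mul1r.
by [].
Unshelve. all: by end_near.
Qed.

Lemma expRN_taylor (v : R) : 0 <= v -> `|expR (- v) - (1 - v)| <= v ^+ 2.
Proof.
move=> v0; have h1 := expR_ge1Dx (- v); have h2 := expR_ge1Dx v.
rewrite ger0_norm; last by lra.
have : expR (- v) <= (1 + v)^-1.
  by rewrite expRN lef_pV2 ?posrE ?expR_gt0// ltr_pwDl.
have : (1 + v)^-1 <= 1 - v + v ^+ 2.
  rewrite -[leLHS]mul1r ler_pdivrMr ?ltr_pwDl//.
  by rewrite (_ : _ * _ = 1 + v ^+ 3) ?lerDl ?exprn_ge0//; ring.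
lra.
Qed.

Lemma dist_expr (a b : R) m : `|a| <= 1 -> `|b| <= 1 ->
  `|a ^+ m - b ^+ m| <= m%:R * `|a - b|.
Proof.
move=> a1 b1; elim: m => [|m IH]; first by rewrite !expr0 subrr normr0 mul0r.
have -> : a ^+ m.+1 - b ^+ m.+1 = a * (a ^+ m - b ^+ m) + (a - b) * b ^+ m.
  by rewrite !exprS; ring.
apply: le_trans (ler_normD _ _) _; rewrite !normrM -natr1 mulrDl mul1r.
apply: lerD; first by apply: le_trans IH; rewrite ler_piMl.
by rewrite ler_piMr// normrX exprn_ile1.
Qed.

(** If [m] is the exponent and [expR (- L)] the limit, both [m (1 - cos _)] and
    [m (1 - expR (- L / m))] tend to [L], and powers of numbers in the unit
    interval satisfy [|a^m - b^m| <= m |a - b|]. *)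
Lemma cos_pow_cvg (j : nat) (x : R) :
  (fun n => cos (x / n.+1%:R / 2) ^+ (2 * (j * n.+1 ^ 2))) @ \oo -->
  expR (- (j%:R * x ^+ 2 / 4)).
Proof.
pose L := j%:R * x ^+ 2 / 4.
have [m mdef] : exists m, forall n, (2 * (j * n.+1 ^ 2))%N = m n by eexists.
under eq_fun do rewrite mdef.
pose a n := cos (x / n.+1%:R / 2).
pose v n : R := x ^+ 2 / (8 * n.+1%:R ^+ 2).
have n1 n : n.+1%:R != 0 :> R by rewrite pnatr_eq0.
have mE n : (m n)%:R = 2 * j%:R * n.+1%:R ^+ 2 :> R.
  by rewrite -mdef natrM natrM natrX mulrA.
have v0 n : 0 <= v n by rewrite divr_ge0 ?sqr_ge0// mulr_ge0// sqr_ge0.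
have mv n : (m n)%:R * v n = L.
  by rewrite mE /v /L; move: (n1 n); move: n.+1%:R => q q0; field.
have expL n : expR (- L) = expR (- v n) ^+ m n.
  by rewrite -expRM_natl mulrN mv.
have am n : (m n)%:R * (1 - a n) = 4 * j%:R * (n.+1%:R * sin (x / 4 / n.+1%:R)) ^+ 2.
  have -> : a n = 1 - sin (x / 4 / n.+1%:R) ^+ 2 *+ 2.
    rewrite /a (_ : x / n.+1%:R / 2 = (x / 4 / n.+1%:R) *+ 2).
      by rewrite cos_mulr2n cos2sin2 !mulr2n; ring.
    by move: (n1 n); move: n.+1%:R => q q0; rewrite mulr2n; field.
  by rewrite mE !mulr2n; ring.
have ma : (fun n => (m n)%:R * (1 - a n)) @ \oo --> L.
  under eq_fun do rewrite am.
  have -> : L = 4 * j%:R * (x / 4) ^+ 2 by rewrite /L; field.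
  apply: cvgM; first exact: cvg_cst.
  have sq := @sin_quotient (x / 4); rewrite expr2.
  under eq_fun do rewrite expr2.
  exact: (cvgM sq sq).
have vv : (fun n => (m n)%:R * v n ^+ 2) @ \oo --> (0 : R).
  have hh : (fun n => x / n.+1%:R) @ \oo --> (0 : R).
    by rewrite -[X in _ --> X](mulr0 x); apply: cvgM; [exact: cvg_cst|exact: cvg_harmonic].
  have -> : (fun n => (m n)%:R * v n ^+ 2) =
      (fun n => L / 8 * ((x / n.+1%:R) * (x / n.+1%:R))).
    apply/funext => n; rewrite expr2 mulrA mv /v.
    by move: (n1 n); move: n.+1%:R => q q0; field.
  have hc := cvgM (cvg_cst (L / 8)) (cvgM hh hh).
  by rewrite !mulr0 in hc; exact: hc.
apply/cvgrPdist_lt => e e0; have e2 : 0 < e / 2 by rewrite divr_gt0.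
have /cvgrPdist_lt/(_ _ e2) h1 := ma; have /cvgrPdist_lt/(_ _ e2) h2 := vv.
apply: filterS2 h1 h2 => n; rewrite sub0r normrN => h1 h2.
rewrite -/L (expL n) -/(a n) distrC.
have b1 : `|expR (- v n)| <= 1.
  by rewrite ger0_norm ?expR_ge0// expR_le1 oppr_le0.
apply: le_lt_trans (dist_expr (m n) (cos_max _) b1) _.
have -> : a n - expR (- v n) = (v n - (1 - a n)) - (expR (- v n) - (1 - v n)) by ring.
apply: le_lt_trans (_ : (m n)%:R * (`|v n - (1 - a n)| + v n ^+ 2) < e).
  rewrite ler_wpM2l//; apply: le_trans (ler_normB _ _) _; rewrite lerD2l.
  exact: expRN_taylor.
rewrite mulrDr [e]splitr; apply: ltrD.
  by rewrite -{1}(ger0_norm (ler0n R (m n))) -normrM mulrBr mv.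
exact: le_lt_trans (ler_norm _) h2.
Qed.

End Characters.

(** * Gaussian smoothing of trigonometric polynomials *)

Section TrigonometricPolynomials.
Context {R : realType}.
Variables (I : Type) (r : seq I) (b : I -> R[i]) (th th' : I -> R) (K : R).

Definition trigpoly (s t : R) : R :=
  complex.Re (\sum_(i <- r) b i * expi (s * th i + t * th' i)).

Hypothesis trig_bound : forall s t, `|trigpoly s t| <= K.

Lemma trig_bound_ge0 : 0 <= K.
Proof. exact: le_trans (normr_ge0 _) (trig_bound 0 0). Qed.

(** A shift by 1 is [k] shifts by the mesh [1/k] of the walk, each costing twice
    the central weight. *)
Lemma walk_shift_bound p k t : (0 < k)%N ->
  `|\sum_(0 <= a < (2 * p).+1) binw p a *
     (trigpoly ((a%:R - p%:R) / k%:R) t - trigpoly ((a%:R - p%:R) / k%:R + 1) t)|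
  <= k%:R * (2 * (K * binw p p)).
Proof.
move=> k0; have kn0 : k%:R != 0 :> R by rewrite pnatr_eq0 -lt0n.
pose f i a := trigpoly ((a%:R - p%:R) / k%:R + i%:R / k%:R) t.
have tele a : trigpoly ((a%:R - p%:R) / k%:R) t -
    trigpoly ((a%:R - p%:R) / k%:R + 1) t = \sum_(0 <= i < k) (f i a - f i a.+1).
  have fS i : f i a.+1 = f i.+1 a.
    rewrite /f; congr trigpoly.
    by rewrite -[a.+1]addn1 -[i.+1]addn1 !natrD; field.
  under eq_bigr do rewrite fS -opprB.
  rewrite sumrN telescope_sumr// opprB /f mul0r addr0.
  by rewrite mulfV.
under eq_bigr do rewrite tele mulr_sumr.
rewrite exchange_big/=; apply: le_trans (ler_norm_sum _ _ _) _.
apply: le_trans (_ : \sum_(0 <= i < k) 2 * (K * binw p p) <= _); last first.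
  by rewrite sumr_const_nat subn0 -[leLHS]mulr_natl.
apply: ler_sum => i _; apply: (@unimodal_abel _ (binw p) (f i)).
- exact: binw_ge0.
- exact: binw_le.
- exact: binw_sym.
- by move=> a; exact: trig_bound.
Qed.

Lemma walk_average p (u : R) (k : nat) t (t' : R) (g : R[i]) :
  \sum_(0 <= a < (2 * p).+1) (binw p a)%:C%C *
     (g * expi ((a%:R - p%:R) / k%:R * u + t * t')) =
  g * expi (t * t') * (cos (u / k%:R / 2) ^+ (2 * p))%:C%C.
Proof.
rewrite -binw_char mulr_sumr; apply: eq_bigr => a _.
rewrite expiD (_ : _ / _ * u = (a%:R - p%:R) * (u / k%:R)); last by rewrite mulrAC mulrA.
by ring.
Qed.

Lemma trig_difference s t : trigpoly s t - trigpoly (s + 1) t =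
  complex.Re (\sum_(i <- r) b i * (1 - expi (th i)) * expi (s * th i + t * th' i)).
Proof.
rewrite /trigpoly -ReB -sumrB; congr complex.Re; apply: eq_bigr => i _.
have -> : (s + 1) * th i + t * th' i = th i + (s * th i + t * th' i) by ring.
by rewrite (expiD (th i)); ring.
Qed.

Lemma walk_average2 p k :
  \sum_(0 <= c < (2 * p).+1) binw p c *
    (\sum_(0 <= a < (2 * p).+1) binw p a *
     (trigpoly ((a%:R - p%:R) / k%:R) ((c%:R - p%:R) / k%:R) -
      trigpoly ((a%:R - p%:R) / k%:R + 1) ((c%:R - p%:R) / k%:R))) =
  \sum_(i <- r) complex.Re (b i * (1 - expi (th i))) *
    (cos (th i / k%:R / 2) ^+ (2 * p) * cos (th' i / k%:R / 2) ^+ (2 * p)).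
Proof.
transitivity (complex.Re (\sum_(i <- r) b i * (1 - expi (th i)) *
    (cos (th i / k%:R / 2) ^+ (2 * p))%:C%C * (cos (th' i / k%:R / 2) ^+ (2 * p))%:C%C)).
  under eq_bigr => c _.
    under eq_bigr do rewrite trig_difference -ReM_real mulr_sumr.
    rewrite -Re_sum exchange_big/=.
    under eq_bigr do rewrite walk_average.
    rewrite -ReM_real mulr_sumr.
    over.
  rewrite -Re_sum exchange_big/=; congr complex.Re; apply: eq_bigr => i _.
  rewrite -(binw_char p (th' i / k%:R)) mulr_sumr; apply: eq_bigr => c _.
  rewrite (_ : _ / _ * th' i = (c%:R - p%:R) * (th' i / k%:R)); last by rewrite mulrAC mulrA.
  by ring.
rewrite Re_sum; apply: eq_bigr => i _.
by rewrite -mulrA -rmorphM mulrC ReM_real mulrC.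
Qed.

Lemma walk_average2_bound p k : (0 < k)%N ->
  `|\sum_(i <- r) complex.Re (b i * (1 - expi (th i))) *
    (cos (th i / k%:R / 2) ^+ (2 * p) * cos (th' i / k%:R / 2) ^+ (2 * p))|
  <= k%:R * (2 * (K * binw p p)).
Proof.
move=> k0; rewrite -walk_average2; apply: le_trans (ler_norm_sum _ _ _) _.
have -> : k%:R * (2 * (K * binw p p)) =
    \sum_(0 <= c < (2 * p).+1) binw p c * (k%:R * (2 * (K * binw p p))).
  by rewrite -mulr_suml binw_sum mul1r.
apply: ler_sum => c _.
rewrite normrM (ger0_norm (binw_ge0 _ _)).
by apply: ler_wpM2l; [exact: binw_ge0|exact: walk_shift_bound].
Qed.

(** A shift by 1 of the walk with [2 * j * n^2] steps of length [1/(2n)] costs at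
    most [2 n K] times the central weight, hence at most [K * sqrt (2/j)], for all [n];
    the Gaussian is the limit in [n].  The bound does not see the frequencies. *)
Lemma gaussian_shift_bound (d : R) (j : nat) : 0 <= d -> 2 <= d ^+ 2 * j%:R ->
  `|\sum_(i <- r) complex.Re (b i * (1 - expi (th i))) *
     expR (- (j%:R * (th i ^+ 2 + th' i ^+ 2) / 4))| <= d * K.
Proof.
move=> d0 dj.
pose p n := (j * n.+1 ^ 2)%N.
have bound n : n.+1%:R * (2 * (K * binw (p n) (p n))) <= d * K.
  have -> : n.+1%:R * (2 * (K * binw (p n) (p n))) = (2 * n.+1%:R * binw (p n) (p n)) * K by ring.
  rewrite ler_wpM2r ?trig_bound_ge0//.
  have j0 : 0 < j%:R :> R.
    rewrite ltr0n lt0n; apply: contraTneq dj => ->.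
    by rewrite mulr0 -ltNge ltr0n.
  rewrite -(@ler_pXn2r _ 2)// ?nnegrE ?mulr_ge0 ?binw_ge0//.
  rewrite -(ler_pM2r j0); apply: le_trans dj.
  have := @binw_central R (p n); rewrite {1}/p natrM natrM natrX.
  by move: (binw _ _) (n.+1%:R) (j%:R) => x y z; lra.
have lim : (fun n => \sum_(i <- r) complex.Re (b i * (1 - expi (th i))) *
    (cos (th i / n.+1%:R / 2) ^+ (2 * p n) * cos (th' i / n.+1%:R / 2) ^+ (2 * p n)))
    @ \oo --> \sum_(i <- r) complex.Re (b i * (1 - expi (th i))) *
     expR (- (j%:R * (th i ^+ 2 + th' i ^+ 2) / 4)).
  elim: r => [|i l IH].
    by rewrite big_nil; under eq_fun do rewrite big_nil; exact: cvg_cst.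
  rewrite big_cons; under eq_fun do rewrite big_cons.
  apply: cvgD => //; apply: cvgM; first exact: cvg_cst.
  rewrite (_ : - _ = - (j%:R * th i ^+ 2 / 4) + - (j%:R * th' i ^+ 2 / 4)); last by field.
  by rewrite expRD; apply: cvgM; exact: cos_pow_cvg.
apply/ler_addgt0Pr => e e0; have /cvgrPdist_lt/(_ _ e0)[n _ hn] := lim.
have := hn n (leqnn n) => {}hn.
have := le_trans (walk_average2_bound (p n) (ltn0Sn n)) (bound n).
move: hn; move: (\sum_(i <- r) _) (\sum_(i <- r) _) => x y.
rewrite !(ler_norml, ltr_norml) => /andP[? ?] /andP[? ?].
by apply/andP; split; lra.
Qed.

End TrigonometricPolynomials.

(** * The algebra of the Weyl operators *)

Section WeylAlgebra.
Context {R : realType} {H : completeNormedModType R[i]}.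
Variable dot : {dot H for @conjC R[i]}.
Context {Hdot : hilbert_norm dot}.
Variable W : R * R -> 'B(H).
Hypotheses (HW : weyl_system dot W) (Wirr : irreducible W).
Local Notation rdot := (rdot dot).

Lemma symplecticNr (z : R * R) : symplectic z (- z) = 0.
Proof. by rewrite /symplectic /=; ring. Qed.

Lemma weyl0 : W 0 = 1.
Proof.
have [V [_ VW _]] := weyl_unitary HW 0.
have s0 : symplectic (0 : R * R) 0 = 0 by rewrite /symplectic /=; ring.
have := weyl_mul HW 0 0; rewrite s0 expi0 scale1r addr0.
by move=> /(congr1 (fun A => V * A)); rewrite mulrA VW mul1r.
Qed.

Lemma weylV z : W z * W (- z) = 1.
Proof. by rewrite (weyl_mul HW) symplecticNr expi0 scale1r subrr weyl0. Qed.

Lemma weyl_radjoint z : radjoint dot (W z) (W (- z)).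
Proof.
have [V [Vadj VW _]] := weyl_unitary HW z.
suff -> : W (- z) = V by exact: adjoint_radjoint.
by rewrite -[W (- z)]mul1r -VW -mulrA weylV mulr1.
Qed.

Lemma weyl_isometry z x : rnorm (W z x) = rnorm x.
Proof.
apply/eqP; rewrite -(@eqrXn2 _ 2)// ?rnorm_ge0// -!(rdotxx (dot:=dot)).
rewrite weyl_radjoint -[W (- z) _]/((W (- z) * W z) x).
by rewrite -{2}[z]opprK weylV.
Qed.

Lemma weyl_comm z w : W w * W z = expi (symplectic w z *+ 2) *: (W z * W w).
Proof.
rewrite !(weyl_mul HW) scalerA -expiD (addrC w z); congr (expi _ *: _).
by rewrite /symplectic; ring.
Qed.

(** Conjugation by [W v] multiplies [W z] by a character of [v]; this is how
    trigonometric polynomials arise. *)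
Lemma weyl_conj v z x : W v (W z (W (- v) x)) = expi (symplectic v z *+ 2) *: W z x.
Proof.
rewrite -[LHS]/((W v * W z) (W (- v) x)) weyl_comm bopZE bopME.
by rewrite -[W v _]/((W v * W (- v)) x) weylV.
Qed.

Definition weyl_poly (s : seq (R[i] * (R * R))) : 'B(H) :=
  \sum_(p <- s) p.1 *: W p.2.

Definition weyl_algebra : set 'B(H) := range weyl_poly.

Let M := weyl_algebra.

Lemma weyl_algebraD A B : M A -> M B -> M (A + B).
Proof.
by move=> [s _ <-] [t _ <-]; exists (s ++ t) => //; rewrite /weyl_poly big_cat.
Qed.

Lemma weyl_algebraW c z : M (c *: W z).
Proof. by exists [:: (c, z)] => //; rewrite /weyl_poly big_seq1. Qed.

Lemma weyl_algebra_sum (I : Type) (r : seq I) (F : I -> 'B(H)) :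
  (forall i, M (F i)) -> M (\sum_(i <- r) F i).
Proof.
move=> hF; elim: r => [|i r IH].
  by exists [::] => //; rewrite /weyl_poly !big_nil.
by rewrite big_cons; apply: weyl_algebraD.
Qed.

Lemma weyl_star_algebra : irreducible_star_algebra dot M.
Proof.
split.
- by rewrite -weyl0 -[W 0]scale1r; exact: weyl_algebraW.
- exact: weyl_algebraD.
- move=> c _ [s _ <-]; rewrite /weyl_poly scaler_sumr.
  by apply: weyl_algebra_sum => p; rewrite scalerA; exact: weyl_algebraW.
- move=> _ _ [s _ <-] [t _ <-]; rewrite /weyl_poly mulr_suml.
  apply: weyl_algebra_sum => p; rewrite mulr_sumr; apply: weyl_algebra_sum => q.
  rewrite bop_scalerAl bop_scalerAr (weyl_mul HW) !scalerA.
  exact: weyl_algebraW.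
- move=> _ [s _ <-]; elim: s => [|[c z] s [B MB hB]].
    exists 0; first by exists [::] => //; rewrite /weyl_poly big_nil.
    by move=> x y; rewrite /weyl_poly big_nil rdot0l rdot0r.
  exists (c^*%C *: W (- z) + B).
    by apply: weyl_algebraD => //; exact: weyl_algebraW.
  rewrite /weyl_poly big_cons => x y; rewrite /= -[LHS]/(rdot ((c *: W z) x + weyl_poly s x) y).
  rewrite rdotDl hB (radjointZ c (weyl_radjoint z)) -rdotDr.
  by [].
- move=> T TM; apply: Wirr.2 => z; apply: TM.
  by rewrite -[W z]scale1r; exact: weyl_algebraW.
Qed.

End WeylAlgebra.

(** * The semigroup almost commutes with the Weyl operators *)

Section Contraction.
Context {R : realType} {H : completeNormedModType R[i]}.
Variable dot : {dot H for @conjC R[i]}.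
Context {Hdot : hilbert_norm dot}.
Local Notation rdot := (rdot dot).

(** [A] is a contraction exactly when the operator matrix with diagonal 1 and
    off-diagonal entries [A] and its adjoint is positive, and a unital
    completely positive map preserves matrices of this shape. *)
Lemma cp_contraction (Phi : 'B(H) -> 'B(H)) A : completely_positive dot Phi ->
  Phi 1 = 1 -> bnd A 1 -> bnd (Phi A) 1.
Proof.
move=> cp Phi1 A1; have [B AB] := radjoint_ex (dot:=dot) A.
pose m (C D : 'B(H)) : 'M['B(H)]_2 := \matrix_(i, j)
  if i == j then 1 else if i == 0 then C else D.
have mE C D (x : 'I_2 -> H) :
    \sum_i \sum_j dot (m C D i j (x j)) (x i) =
    dot (x 0) (x 0) + dot (C (x 1)) (x 0) + (dot (D (x 0)) (x 1) + dot (x 1) (x 1)).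
  rewrite !big_ord_recl !big_ord0 !addr0 /m !mxE/=.
  by rewrite (_ : lift ord0 ord0 = 1)//; apply/val_inj.
have pos : positive_opmx dot (m A B).
  move=> x; rewrite mE lecE !ImD !ReD !Im_dot !rdot_ixx.
  have -> : rdot ('i%C *: B (x 0)) (x 1) = - rdot ('i%C *: A (x 1)) (x 0).
    by rewrite -[LHS]opprK -rdot_ir (radjointC AB) bopZ rdotC.
  apply/andP; split; first by apply/eqP; rewrite /=; ring.
  rewrite -!/(rdot _ _) (radjointC AB) (rdotC dot (x 0)) !rdotxx /=.
  have := @rdot_CS _ _ dot Hdot (A (x 1)) (x 0); have := A1 (x 1).
  have := rnorm_ge0 (x 0); have := sqr_ge0 (rnorm (x 0) - rnorm (x 1)).
  rewrite mul1r ler_norml => h1 h2 h3 /andP[h4 _].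
  have : rnorm (A (x 1)) * rnorm (x 0) <= rnorm (x 1) * rnorm (x 0) by rewrite ler_wpM2r.
  by move: h1 h4; rewrite sqrrB; lra.
have /= pos' : positive_opmx dot (m (Phi A) (Phi B)).
  have := cp _ _ pos; rewrite (_ : map_mx Phi _ = m (Phi A) (Phi B))//.
  by apply/matrixP => i j; rewrite !mxE; case: ifP => // _; case: ifP.
have {}pos' u v : rdot ('i%C *: Phi A v) u + rdot ('i%C *: Phi B u) v = 0 /\
    0 <= rnorm u ^+ 2 + rdot (Phi A v) u + rdot (Phi B u) v + rnorm v ^+ 2.
  have := pos' (fun i => if i == 0 then u else v).
  rewrite mE/= lecE !ImD !ReD !Im_dot !rdot_ixx => /andP[/eqP/= h1].
  rewrite -!/(rdot _ _) !rdotxx /= => h2; split; lra.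
have sym u v : rdot (Phi A v) u = rdot (Phi B u) v.
  have [+ _] := pos' u ('i%C *: v).
  by rewrite bopZ scalerA -expr2 sqr_i scaleN1r rdotNl rdot_ii; lra.
move=> v; rewrite mul1r; have [_] := pos' (- Phi A v) v.
rewrite -sym rdotNr rdotxx rnormN => h.
rewrite -(@ler_pXn2r _ 2)// ?nnegrE ?rnorm_ge0//; lra.
Qed.

End Contraction.

Section Commutator.
Context {R : realType} {H : completeNormedModType R[i]}.
Variable dot : {dot H for @conjC R[i]}.
Context {Hdot : hilbert_norm dot}.
Variable W : R * R -> 'B(H).
Hypotheses (HW : weyl_system dot W) (Wirr : irreducible W).
Variable phi : R -> 'B(H) -> 'B(H).
Hypotheses (Hphi : cp_semigroup dot phi)
  (phiW : forall (t : R) (z : R * R), 0 <= t ->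
      phi t (W z) = (expR (- t * sqnorm z))%:C%C *: W z).
Local Notation rdot := (rdot dot).
Local Notation selfadjoint := (selfadjoint dot).

Lemma phiD t A B : 0 <= t -> phi t (A + B) = phi t A + phi t B.
Proof. by move=> t0; have := cps_linear Hphi t0 1 A B; rewrite !scale1r. Qed.

Lemma phi0 t : 0 <= t -> phi t 0 = 0.
Proof.
move=> t0; have := phiD 0 0 t0; rewrite addr0 => /eqP.
by rewrite -subr_eq0 opprD addNKr oppr_eq0 => /eqP.
Qed.

Lemma phiZ t c A : 0 <= t -> phi t (c *: A) = c *: phi t A.
Proof.
by move=> t0; have := cps_linear Hphi t0 c A 0; rewrite !addr0 phi0// addr0.
Qed.

Lemma phi_contraction t A : 0 <= t -> bnd A 1 -> bnd (phi t A) 1.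
Proof.
move=> t0; apply: (cp_contraction (dot:=dot)); first exact: (cps_cp Hphi).
exact: (cps_unital Hphi).
Qed.

Definition commutator_coef (t : R) (w : R * R) (x y : H) (A : 'B(H)) : R :=
  rdot (phi t A (W w x)) y - rdot (W w (phi t A x)) y.

Lemma commutator_coefE t w x y A : commutator_coef t w x y A =
  rdot (phi t A (W w x)) y - rdot (phi t A x) (W (- w) y).
Proof. by rewrite /commutator_coef (weyl_radjoint HW). Qed.

Lemma commutator_coef_cont t w x y : 0 <= t ->
  continuous (commutator_coef t w x y : weak_star dot -> R).
Proof.
have -> : commutator_coef t w x y = fun A =>
    rdot (phi t A (W w x)) y - rdot (phi t A x) (W (- w) y).
  by apply/funext => A; exact: commutator_coefE.
move=> t0 A; have /(_ A) nA := cps_normal Hphi t0.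
have c u v := @cvg_comp (weak_star dot) (weak_star dot) R (phi t)
  (fun B => rdot (B u) v) _ _ _ nA
  (@rdot_weak_star_continuous _ _ dot u v (phi t A)).
exact: (cvgB (c _ _) (c _ _)).
Qed.

Lemma commutator_coef_bound t w x y A : 0 <= t -> bnd A 1 ->
  `|commutator_coef t w x y A| <= 2 * (rnorm x * rnorm y).
Proof.
move=> t0 A1; have := phi_contraction t0 A1; rewrite /bnd => P1.
apply: le_trans (ler_normB _ _) _; rewrite mulr_natl mulr2n.
apply: lerD; apply: le_trans (rdot_CS _ _) _; apply: ler_wpM2r; rewrite ?rnorm_ge0//.
  by have := P1 (W w x); rewrite (weyl_isometry HW) mul1r.
by rewrite (weyl_isometry HW); have := P1 x; rewrite mul1r.
Qed.

(** On the Weyl algebra the commutator with [W w] after time [j |w|^2 / 4] is a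
    Gaussian smoothing of the difference of a trigonometric polynomial with its
    unit shift, where the polynomial records the matrix coefficient of
    [W v A W v^*] for [v] in the basis formed by [w] and its rotation. *)
Lemma commutator_coef_weyl (j : nat) (d : R) w x y A : 0 <= d -> 2 <= d ^+ 2 * j%:R ->
  weyl_algebra W A -> bnd A 1 ->
  `|commutator_coef (j%:R * sqnorm w / 4) w x y A| <= d * (rnorm x * rnorm y).
Proof.
move=> d0 dj [s _ sA] A1.
pose t := j%:R * sqnorm w / 4; rewrite -/t.
have w0 : 0 <= sqnorm w by rewrite addr_ge0// sqr_ge0.
have t0 : 0 <= t by rewrite divr_ge0// mulr_ge0.
(* w and w' are orthogonal of the same length: th^2 + th'^2 = |w|^2 |z|^2 *)
pose w' : R * R := (- w.2, w.1).
pose th (p : R[i] * (R * R)) := symplectic w p.2 *+ 2.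
pose th' (p : R[i] * (R * R)) := symplectic w' p.2 *+ 2.
pose x' := W w x.
pose b (p : R[i] * (R * R)) := p.1 * dot (W p.2 x') y.
have tpE a c : trigpoly s b th th' a c =
    rdot (A (W (- (a * w.1 + c * w'.1, a * w.2 + c * w'.2)) x'))
         (W (- (a * w.1 + c * w'.1, a * w.2 + c * w'.2)) y).
  set v := (_, _).
  rewrite -(weyl_radjoint HW) /trigpoly -sA /weyl_poly bop_sumE bop_sumf rdot_suml Re_sum.
  apply: eq_bigr => p _; rewrite bopZE bopZ (weyl_conj HW) scalerA /b.
  have e1 (g : R[i]) u : dot (g *: u) y = g * dot u y by exact: linearZl_LR.
  rewrite rdotE e1 mulrAC; congr (complex.Re (_ * _ * _)); congr expi.
  by rewrite /th /th' /v /w' /symplectic /=; field.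
have tp_bound a c : `|trigpoly s b th th' a c| <= rnorm x * rnorm y.
  rewrite tpE; apply: le_trans (rdot_CS _ _) _; rewrite (weyl_isometry HW).
  apply: ler_wpM2r; first exact: rnorm_ge0.
  by have := A1 (W (- (a * w.1 + c * w'.1, a * w.2 + c * w'.2)) x');
    rewrite mul1r !(weyl_isometry HW).
have := gaussian_shift_bound tp_bound d0 dj.
suff -> : commutator_coef t w x y A = \sum_(p <- s) complex.Re (b p * (1 - expi (th p))) *
    expR (- (j%:R * (th p ^+ 2 + th' p ^+ 2) / 4)) by [].
have phiA : phi t A = \sum_(p <- s) p.1 *: ((expR (- t * sqnorm p.2))%:C%C *: W p.2).
  rewrite -sA /weyl_poly (big_morph (phi t) (fun B D => phiD B D t0) (phi0 t0)).
  by apply: eq_bigr => p _; rewrite phiZ// phiW.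
rewrite /commutator_coef phiA !bop_sumE bop_sumf !rdot_suml -sumrB; apply: eq_bigr => p _.
have e1 (g : R[i]) u : dot (g *: u) y = g * dot u y by exact: linearZl_LR.
rewrite !bopZE !bopZ -[W w (W p.2 x)]/((W w * W p.2) x) (weyl_comm HW) bopZE bopME.
rewrite !rdotE !e1 -ReB.
have -> : - (j%:R * (th p ^+ 2 + th' p ^+ 2) / 4) = - t * sqnorm p.2.
  by rewrite /th /th' /t /w' /symplectic /sqnorm /=; field.
rewrite [RHS]mulrC -ReM_real /b -/x' -/(th p); congr complex.Re.
by ring.
Qed.

(** Beyond the time [t0] at which the estimate is obtained, [phi t] is [phi t0]
    composed with a contraction, so that the bound persists. *)
Lemma commutator_coef_small w x y (e : R) : 0 < e -> exists2 t0 : R, 0 <= t0 &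
  forall t A, t0 <= t -> bnd A 1 -> `|commutator_coef t w x y A| <= e.
Proof.
move=> e0; pose K := rnorm x * rnorm y.
have K0 : 0 <= K by rewrite mulr_ge0 ?rnorm_ge0.
(* twice the constant 3 of [kaplansky_estimate], for the two self-adjoint parts;
   K + 1 because that lemma asks for a positive bound *)
pose d := e / 6 / (K + 1).
have K1 : 0 < K + 1 by rewrite ltr_wpDl.
have d0 : 0 < d by rewrite !divr_gt0.
have [j hj] : exists j : nat, 2 <= d ^+ 2 * j%:R.
  have d2 : 0 < d ^+ 2 by rewrite exprn_gt0.
  exists (Num.truncn (2 / d ^+ 2)).+1; rewrite mulrC -ler_pdivrMr//.
  exact/ltW/truncnS_gt.
pose t0 := j%:R * sqnorm w / 4.
have t00 : 0 <= t0 by rewrite divr_ge0// mulr_ge0// addr_ge0// sqr_ge0.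
have sa_bound y' A : rnorm y' = rnorm y -> selfadjoint A -> bnd A 1 ->
    `|commutator_coef t0 w x y' A| <= 3 * (d * (K + 1)).
  move=> yy' hA A1.
  apply: (@kaplansky_estimate _ _ dot _ (weyl_algebra W) (weyl_star_algebra HW Wirr)
    (commutator_coef t0 w x y') _ (2 * K)) => //.
  - exact: mulr_gt0.
  - by move=> B C; rewrite /commutator_coef phiD// !bopE bopD !rdotDl; ring.
  - by move=> a B; rewrite /commutator_coef phiZ// !bopZE bopZ !rdotZl; ring.
  - exact: commutator_coef_cont.
  - by move=> B B1; have := commutator_coef_bound w x y' t00 B1; rewrite yy'.
  - move=> B MB B1; apply: le_trans (commutator_coef_weyl w x y' (ltW d0) hj MB B1) _.
    by rewrite yy' ler_wpM2l ?(ltW d0)// lerDl.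
have all_bound A : bnd A 1 -> `|commutator_coef t0 w x y A| <= e.
  move=> A1; have [B [D [AE hB hD B1 D1]]] := cartesian_decomposition (dot:=dot) A1.
  have h1 := sa_bound y B erefl hB B1.
  have h2 := sa_bound _ D (rnorm_i y) hD D1.
  have -> : commutator_coef t0 w x y A =
      commutator_coef t0 w x y B - commutator_coef t0 w x ('i%C *: y) D.
    rewrite AE /commutator_coef phiD// phiZ// !bopE !bopZE bopD bopZ !rdotDl !rdot_ir.
    by ring.
  apply: le_trans (ler_normB _ _) _; apply: le_trans (lerD h1 h2) _.
  have -> : 3 * (d * (K + 1)) + 3 * (d * (K + 1)) = 6 * (d * (K + 1)) by ring.
  by rewrite /d divfK ?gt_eqF// mulrC divfK.
exists t0 => // t A tt0 A1.
have t1 : 0 <= t - t0 by rewrite subr_ge0.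
have -> : commutator_coef t w x y A = commutator_coef t0 w x y (phi (t - t0) A).
  rewrite /commutator_coef (_ : phi t A = phi t0 (phi (t - t0) A))//.
  by rewrite -(cps_comp Hphi)// addrCA subrr addr0.
by apply: all_bound; exact: phi_contraction.
Qed.

End Commutator.

(** * Weak limits along ultrafilters and purity *)

Section UltrafilterLimits.
Context {R : realType} {H : completeNormedModType R[i]}.
Variable dot : {dot H for @conjC R[i]}.
Context {Hdot : hilbert_norm dot}.
Local Notation rdot := (rdot dot).
Context {I : Type} {G : set_system I}.
Hypothesis GU : UltraFilter G.

Lemma ultra_fmap (J : Type) (f : I -> J) : UltraFilter (f @ G).
Proof.
split=> [|F' FF' sub]; first exact: fmap_proper_filter.
apply/seteqP; split=> P; last exact: sub.
move=> F'P; have [//|GnP] := in_ultra_setVsetC (f @^-1` P) GU.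
have := filterI F'P (sub (~` P) GnP); rewrite setICr => F0.
by case: (@filter_not_empty _ F' FF' (F0 _)).
Qed.

Lemma ultra_real_cvg (u : I -> R) (C : R) : (forall i, `|u i| <= C) ->
  exists l : R, u @ G --> l.
Proof.
move=> uC; have := @segment_compact R (- C) C; rewrite compact_ultra => cpt.
have [|l [_ hl]] := cpt (u @ G) (ultra_fmap u); last by exists l.
suff : G (u @^-1` `[- C, C]%classic) by [].
apply: filterS filterT => i _.
by rewrite /= in_itv/= -ler_norml.
Qed.

(** Weak compactness of the unit ball. *)
Lemma ultra_bop_cvg (B : I -> 'B(H)) : (forall i, bnd (B i) 1) ->
  exists2 T : 'B(H), bnd T 1 &
    forall x y, (fun i => rdot (B i x) y) @ G --> rdot (T x) y.
Proof.
move=> B1.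
have Bxy i x y : `|rdot (B i x) y| <= 1 * rnorm x * rnorm y.
  apply: le_trans (rdot_CS _ _) _.
  by apply: ler_wpM2r; [exact: rnorm_ge0|exact: B1].
have /choice[b hb] : forall p : H * H, exists l : R,
    (fun i => rdot (B i p.1) p.2) @ G --> l.
  by move=> [x y]; apply: ultra_real_cvg => i; exact: Bxy.
have lim_eq (u : I -> R) (l l' : R) : u @ G --> l -> u @ G --> l' -> l = l'.
  by apply: cvg_unique; exact: norm_hausdorff.
have bE x y (l : R) : (fun i => rdot (B i x) y) @ G --> l -> b (x, y) = l.
  exact: lim_eq (hb (x, y)).
have [||||||T hT T1] := @form_bop _ _ dot _ (fun x y => b (x, y)) 1.
- move=> x x' y; apply: bE; under eq_fun do rewrite bopD rdotDl.
  exact: (cvgD (hb (x, y)) (hb (x', y))).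
- move=> x y y'; apply: bE; under eq_fun do rewrite rdotDr.
  exact: (cvgD (hb (x, y)) (hb (x, y'))).
- move=> a x y; apply: bE; under eq_fun do rewrite bopZ rdotZl.
  exact: (cvgM (cvg_cst a) (hb (x, y))).
- move=> a x y; apply: bE; under eq_fun do rewrite rdotZr.
  exact: (cvgM (cvg_cst a) (hb (x, y))).
- move=> x y; apply: bE; under eq_fun do rewrite bopZ -[rdot _ _]opprK -rdot_ir.
  exact: (cvgN (hb (x, 'i%C *: y))).
- move=> x y; apply/ler_addgt0Pr => e e0.
  have /cvgrPdist_lt/(_ _ e0)/filter_ex[i hi] := hb (x, y).
  have := Bxy i x y; move: hi => /=; move: (b _) (rdot _ _) => p q.
  rewrite !(ler_norml, ltr_norml) => /andP[? ?] /andP[? ?].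
  by apply/andP; split; lra.
by exists T => // x y; rewrite hT; exact: hb.
Qed.

End UltrafilterLimits.

Section Norms.
Context {R : realType} {H : completeNormedModType R[i]}.

Lemma opnorm_bnd (A : 'B(H)) : (opnorm A <= 1)%E -> bnd A 1.
Proof.
move=> A1 x; rewrite mul1r; have [x0|x0] := eqVneq (rnorm x) 0.
  by rewrite (rnorm_eq0 x0) linear0 rnorm0.
have xp : 0 < rnorm x by rewrite lt_def x0 rnorm_ge0.
pose u := ((rnorm x)^-1)%:C%C *: x.
have : (rnorm (A u))%:E%E = (rnorm (A u))%:E%E by [].
have : ((rnorm (A u))%:E <= opnorm A)%E.
  apply: ereal_sup_ubound; exists u => //=.
  by rewrite rnormE rnormZR ger0_norm ?invr_ge0 ?rnorm_ge0// mulVf.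
move=> /le_trans/(_ A1); rewrite lee_fin bopZ rnormZR ger0_norm ?invr_ge0 ?rnorm_ge0//.
by rewrite mulrC ler_pdivrMr// mul1r.
Qed.

Lemma funnorm_cvg0 (f : R -> 'B(H) -> R[i]) : (forall t, 0 <= t -> f t 0 = 0) ->
  (forall e : R, 0 < e -> exists t0 : R, forall t A, t0 <= t -> bnd A 1 ->
    complex.Re `|f t A| <= e) ->
  funnorm (f t) @[t --> +oo] --> 0%E.
Proof.
move=> f0 hf P P0.
have /nbhs_ballP[e /= e0 eP] : nbhs (0 : R) (fun r => P r%:E) := P0.
have e2 : 0 < e / 2 by rewrite divr_gt0.
have [t0 ht0] := hf _ e2.
exists (Num.max t0 0); split; first exact: num_real.
move=> t; rewrite gt_max => /andP[/ltW tt0 /ltW t_ge0] /=.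
have fn_le : (funnorm (f t) <= (e / 2)%:E)%E.
  apply: ge_ereal_sup => _ [A /opnorm_bnd A1 <-].
  by rewrite lee_fin; exact: ht0.
have fn_ge : (0 <= funnorm (f t))%E.
  apply: ereal_sup_ubound; exists 0; last by rewrite (f0 _ t_ge0) normr0.
  apply: ge_ereal_sup => _ [x _ <-].
  by rewrite lee_fin -/(rnorm (0 : H)) rnorm0 ler01.
have fn_fin : funnorm (f t) = (fine (funnorm (f t)))%:E.
  by rewrite fineK// ge0_fin_numE// (le_lt_trans fn_le)// ltry.
move: fn_le fn_ge; rewrite fn_fin !lee_fin => h1 h2.
suff hb : ball (0 : R) e (fine (funnorm (f t))) by exact: (eP _ hb).
rewrite -ball_normE /ball_/= sub0r normrN ger0_norm//; lra.
Qed.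

End Norms.

Lemma normal_state_scalar (R : realType) (H : completeNormedModType R[i])
    (dot : {dot H for @conjC R[i]}) (rho : 'B(H) -> R[i]) :
  normal_state dot rho -> rho 0 = 0 /\ forall c, rho (c *: (1 : 'B(H))) = c.
Proof.
move=> hrho; have rhoD := state_linear hrho.
have rho0 : rho 0 = 0.
  have /eqP := rhoD 1 0 0; rewrite scale1r addr0 mul1r.
  by rewrite -subr_eq0 opprD addNKr oppr_eq0 => /eqP.
split=> // c; have := rhoD c 1 0.
by rewrite !addr0 rho0 addr0 (state_unital hrho) mulr1.
Qed.

Theorem theorem3p6 (R : realType) (H : completeNormedModType R[i])
    (dot : {dot H for @conjC R[i]}) (Hdot : hilbert_norm dot)
    (W : R * R -> 'B(H)) (HW : weyl_system dot W) (Wirr : irreducible W)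
    (phi : R -> 'B(H) -> 'B(H)) (Hphi : cp_semigroup dot phi)
    (phiW : forall (t : R) (z : R * R), 0 <= t ->
      phi t (W z) = (expR (- t * sqnorm z))%:C%C *: W z) :
  pure dot phi.
Proof.
move=> rho1 rho2 h1 h2; apply: funnorm_cvg0.
  move=> t t0; rewrite (phi0 Hphi t0).
  by rewrite (normal_state_scalar h1).1 (normal_state_scalar h2).1 subrr.
move=> e e0; apply: contrapT => /forallNP no_t0.
have /choice[tA htA] : forall n : nat, exists p : R * 'B(H),
    [/\ n%:R <= p.1, bnd p.2 1 & e < complex.Re `|rho1 (phi p.1 p.2) - rho2 (phi p.1 p.2)|].
  move=> n; have /existsNP[t /existsNP[A]] := no_t0 n%:R.
  move=> /not_implyP[nt /not_implyP[A1 /negP]]; rewrite -ltNge => he.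
  by exists (t, A).
(* the weak limit of the counterexamples along an ultrafilter finer than infinity *)
have [G [GU Goo]] := @ultraFilterLemma nat \oo _.
pose B n := phi (tA n).1 (tA n).2.
have t0 n : 0 <= (tA n).1 by have [+ _ _] := htA n; apply: le_trans.
have B1 n : bnd (B n) 1 by apply: (phi_contraction Hphi) => //; have [] := htA n.
have [T T1 hT] := ultra_bop_cvg (dot:=dot) GU B1.
have T_comm z : T * W z = W z * T.
  apply: bop_ext => x; rewrite !bopME; apply: (@rdot_inj _ _ dot) => y.
  apply/eqP; rewrite -subr_eq0 -normr_le0; apply/ler_addgt0Pr => d d0.
  rewrite add0r; have d2 : 0 < d / 2 by rewrite divr_gt0.
  have [s0 s0_ge0 hs0] := commutator_coef_small HW Wirr Hphi phiW z x y d2.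
  have lim : (fun n => commutator_coef dot W phi (tA n).1 z x y (tA n).2) @ G -->
      rdot dot (T (W z x)) y - rdot dot (W z (T x)) y.
    rewrite (weyl_radjoint HW); under eq_fun do rewrite commutator_coefE//.
    exact: (cvgB (hT _ _) (hT _ _)).
  have large : \forall n \near G, s0 <= (tA n).1.
    apply: Goo; exists (Num.truncn s0).+1 => // n /= hn.
    have [nt _ _] := htA n; apply: le_trans nt.
    by apply: le_trans (ltW (truncnS_gt s0)) _; rewrite ler_nat.
  have /cvgrPdist_lt/(_ _ d2) close := lim.
  have [n [hn1 hn2]] := filter_ex (filterI large close).
  have [_ A1 _] := htA n; have := hs0 _ _ hn1 A1; move: hn2.
  move: (_ - _) (commutator_coef _ _ _ _ _ _ _ _) => p q.
  rewrite !(ler_norml, ltr_norml) => /andP[? ?] /andP[? ?].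
  by apply/andP; split; lra.
have [c Tc] := Wirr.2 T T_comm.
have rhoT rho : normal_state dot rho -> rho \o B @ G --> c.
  move=> hrho.
  rewrite -[X in _ --> X](normal_state_scalar hrho).2 -Tc.
  have BT : (B : nat -> weak_star dot) @ G --> (T : weak_star dot).
    by apply: (@weak_star_net_cvg _ _ dot _ _ _ _ _ 1) => //; apply: filterS filterT.
  have /(_ T) nT := state_normal hrho.
  exact: (@cvg_comp nat (weak_star dot) R[i] B rho _ _ _ BT nT).
have lim : (fun n => rho1 (B n) - rho2 (B n)) @ G --> (0 : R[i]).
  by rewrite -(subrr c); exact: (cvgB (rhoT _ h1) (rhoT _ h2)).
have /cvgrPdist_lt/(_ e%:C%C) := lim; rewrite ltcR => /(_ e0)/filter_ex[n].
rewrite sub0r normrN /= => hn; have [_ _] := htA n.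
move: hn; rewrite normc_def/= ltcR => /lt_trans h /h; by rewrite ltxx.
Qed.
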